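(* Assume $H\neq 0$ and that there exist positive constants $\beta<\infty$ and $\theta<\infty$ such that the relations $$\|\nabla f(X)\|^2\le \beta^2\,\mathbb{E}[\|\nabla f(X)\|^2],\qquad \|\nabla f(X)-\nabla g(X)\|^2\le \theta^2\,\mathbb{E}[\|\nabla f(X)\|^2]$$ hold almost surely. Let $\widehat H_{MF}$ be the multifidelity estimator of $H$ built with $m_1\ge 1$ and $m_2\ge 1$ samples (defined in the context), and assume $$m_2\ge m_1\max\left\{\frac{(\theta+\beta)^2(1+\theta)^2}{\theta^2(2+\theta)^2}\,;\,\frac{(\theta+\beta)^2}{\theta(2\beta+\theta)}\right\}.$$ Then, for any $\varepsilon>0$, the condition $$m_1\ge \varepsilon^{-2}\,\delta_H\,\theta\,\log(2d)\,\max\left\{4\delta_H\theta(2+\theta)^2\,;\,\tfrac{2}{3}(2\beta+\theta)\right\}$$ is sufficient to ensure $$\mathbb{E}[\|H-\widehat H_{MF}\|]\le(\varepsilon+\varepsilon^2)\|H\|.$$ Furthermore, for any $0<\varepsilon\le 1$ and $0<\eta<1$, the condition $$m_1\ge \varepsilon^{-2}\,\delta_H\,\theta\,\log(2d/\eta)\,\left(4\delta_H\theta(2+\theta)^2+\tfrac{4}{3}\varepsilon(2\beta+\theta)\right)$$ is sufficient to ensure $$\mathbb{P}\{\|H-\widehat H_{MF}\|\le\varepsilon\|H\|\}\ge 1-\eta.$$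
   Context: Let $d\in\mathbb{N}$, $d\ge1$, let $\mathcal{X}\subseteq\mathbb{R}^d$, let $\rho$ be a probability density on $\mathcal{X}$, and let $X\sim\rho$ be a random variable with values in $\mathcal{X}$. Let $f:\mathcal{X}\to\mathbb{R}$ (high-fidelity function) and $g:\mathcal{X}\to\mathbb{R}$ (low-fidelity function) be differentiable, with every component of $\nabla f$ and $\nabla g$ square integrable with respect to $\rho$. The active subspace matrix is $H=\mathbb{E}[\nabla f(X)\nabla f(X)^T]\in\mathbb{R}^{d\times d}$. For vectors $\|\cdot\|$ is the Euclidean norm, and for matrices it is the operator (spectral) norm. The intrinsic dimension of $H$ is $\delta_H=\operatorname{trace}(H)/\|H\|$. $\log$ is the natural logarithm. For integers $m_1,m_2\ge1$, the multifidelity estimator of $H$ is $$\widehat H_{MF}=\frac{1}{m_1}\sum_{i=1}^{m_1}\left(\nabla f(X_i)\nabla f(X_i)^T-\nabla g(X_i)\nabla g(X_i)^T\right)+\frac{1}{m_2}\sum_{i=m_1+1}^{m_1+m_2}\nabla g(X_i)\nabla g(X_i)^T,$$ where $X_1,\dots,X_{m_1+m_2}$ are independent copies of $X\sim\rho$. *)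

(* Defs.v *)
From HB Require Import structures.
From mathcomp Require Import all_boot all_order all_algebra.
From mathcomp Require Import all_classical all_reals all_analysis.

Set Implicit Arguments.
Unset Strict Implicit.
Unset Printing Implicit Defensive.

Import Order.TTheory GRing.Theory Num.Theory.
Import numFieldNormedType.Exports.

Local Open Scope classical_set_scope.
Local Open Scope ring_scope.

(* The product sigma-algebra on matrices. Over a [realType] it is the Borel
   sigma-algebra, so that ['cV[R]_d] is the measurable space R^d. *)
Definition measure_matrix_display : measure_display -> measure_display.
Proof. exact. Qed.

Section measurable_matrix.
Context {disp : measure_display} {T : measurableType disp} (m n : nat).

Definition matrix_cylinder : set (set 'M[T]_(m, n)) :=
  [set E | exists i j (A : set T),
     measurable A /\ E = (fun M : 'M[T]_(m, n) => M i j) @^-1` A].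

Let matrix_set0 : <<s matrix_cylinder >> set0.
Proof. exact: sigma_algebra0. Qed.

Let matrix_setC A : <<s matrix_cylinder >> A -> <<s matrix_cylinder >> (~` A).
Proof. exact: sigma_algebraC. Qed.

Let matrix_bigcup (F : _^nat) : (forall i, <<s matrix_cylinder >> (F i)) ->
  <<s matrix_cylinder >> (\bigcup_i F i).
Proof. exact: sigma_algebra_bigcup. Qed.

HB.instance Definition _ :=
  @isMeasurable.Build (measure_matrix_display disp) 'M[T]_(m, n)
    <<s matrix_cylinder >> matrix_set0 matrix_setC matrix_bigcup.

End measurable_matrix.

Lemma measurable_entry {disp} {T : measurableType disp} m n
    (i : 'I_m) (j : 'I_n) :
  measurable_fun [set: 'M[T]_(m, n)] (fun M : 'M[T]_(m, n) => M i j).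
Proof.
move=> _ A mA; rewrite setTI; apply: sub_sigma_algebra.
by exists i, j, A.
Qed.

Lemma measurable_fun_matrix {d1 d2} {T1 : measurableType d1}
    {T2 : measurableType d2} m n (D : set T1) (F : T1 -> 'M[T2]_(m, n)) :
  measurable D -> (forall i j, measurable_fun D (fun x => F x i j)) ->
  measurable_fun D F.
Proof.
move=> mD mF; apply: (@measurability _ _ _ _ _ F (@matrix_cylinder _ T2 m n)).
  by [].
by move=> _ [_ [i [j [A [mA ->]]]] <-]; exact: mF.
Qed.

(* The library's sigma-finiteness instance for products is shadowed by the one
   for products of subprobabilities; hence this restatement. *)
Lemma sigma_finite_product {d1 d2} {T1 : measurableType d1}
    {T2 : measurableType d2} {R : realType}
    (m1 : {sigma_finite_measure set T1 -> \bar R})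
    (m2 : {sigma_finite_measure set T2 -> \bar R}) :
  sigma_finite setT (m1 \x m2)%E.
Proof.
have /sigma_finiteP[F [TF ndF Foo]] := sigma_finiteT m1.
have /sigma_finiteP[G [TG ndG Goo]] := sigma_finiteT m2.
exists (fun n => F n `*` G n).
  rewrite -setXTT TF TG predeqE => -[x y]; split.
    move=> [/= [n _ Fnx] [k _ Gky]]; exists (maxn n k) => //; split.
    - by move: x Fnx; exact/subsetPset/ndF/leq_maxl.
    - by move: y Gky; exact/subsetPset/ndG/leq_maxr.
  by move=> [n _ []/= ? ?]; split; exists n.
move=> k; have [? ?] := Foo k; have [? ?] := Goo k.
split; first exact: measurableX.
by rewrite product_measure1E// lte_mul_pinfty// ge0_fin_numE.
Qed.

(* Lebesgue measure on R^n, by induction on n: the image of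
   (Lebesgue on R) x (Lebesgue on R^n) under R x R^n ~ R^(1 + n); on the
   one-point space R^0 it is the unit mass. *)
Section lebesgue_cV.
Context {R : realType}.

Definition cons_cV n (p : measurableTypeR R * 'cV[R]_n) : 'cV[R]_n.+1 :=
  col_mx (const_mx p.1 : 'cV[R]_1) p.2.

Lemma cons_cV0 n p : @cons_cV n p ord0 0 = p.1.
Proof.
rewrite /cons_cV (_ : ord0 = lshift n (0 : 'I_1)); last exact/val_inj.
by rewrite (col_mxEu (const_mx p.1 : 'cV[R]_1) p.2 0 0) mxE.
Qed.

Lemma cons_cVS n p (i : 'I_n) : @cons_cV n p (lift ord0 i) 0 = p.2 i 0.
Proof.
rewrite /cons_cV (_ : lift ord0 i = rshift 1 i); last exact/val_inj.
by rewrite (col_mxEd (const_mx p.1 : 'cV[R]_1) p.2 i 0).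
Qed.

Lemma measurable_cons_cV n : measurable_fun setT (@cons_cV n).
Proof.
apply: measurable_fun_matrix => // i j; rewrite (ord1 j).
have [k ->|->] := unliftP ord0 i.
- under eq_fun do rewrite cons_cVS.
  apply: (measurableT_comp (measurable_entry k 0)); exact: measurable_snd.
- under eq_fun do rewrite cons_cV0.
  exact: measurable_fst.
Qed.

Section step.
Context n (mu : {sigma_finite_measure set 'cV[R]_n -> \bar R}).

Definition lebesgue_cV_step : set 'cV[R]_n.+1 -> \bar R :=
  pushforward ((@lebesgue_measure R) \x mu)%E (@cons_cV n).

Let pushm := measure_function_pushforward__canonical__measure_function_Measure
  ((@lebesgue_measure R) \x mu)%E (@measurable_cons_cV n).

HB.instance Definition _ := isMeasure.Build _ _ _ lebesgue_cV_step
  (measure0 pushm) (measure_ge0 pushm)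
  (@measure_semi_sigma_additive _ _ _ pushm).

Let uncons (v : 'cV[R]_n.+1) : measurableTypeR R * 'cV[R]_n :=
  (v ord0 0, \col_i v (lift ord0 i) 0).

Let consK : cancel (@cons_cV n) uncons.
Proof.
move=> p; rewrite /uncons cons_cV0 [p in RHS]surjective_pairing; congr pair.
by apply/colP => i; rewrite mxE cons_cVS.
Qed.

Let measurable_uncons : measurable_fun setT uncons.
Proof.
apply/measurable_fun_pairP; split; first exact: measurable_entry.
apply: measurable_fun_matrix => // i j.
under eq_fun do rewrite mxE.
exact: measurable_entry.
Qed.

Let sigma_finite_step : sigma_finite setT lebesgue_cV_step.
Proof.
have [F FT mF] := sigma_finite_product (@lebesgue_measure R) mu.
exists (fun k => uncons @^-1` F k).
  by rewrite -preimage_bigcup -FT preimage_setT.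
move=> k; have [mFk Fk_fin] := mF k; split.
  by rewrite -[X in measurable X]setTI; exact: measurable_uncons.
rewrite /lebesgue_cV_step /pushforward.
rewrite (_ : _ @^-1` _ = F k)//.
by apply/seteqP; split => p; rewrite /preimage/= consK.
Qed.

HB.instance Definition _ :=
  Measure_isSigmaFinite.Build _ _ _ lebesgue_cV_step sigma_finite_step.

End step.

Fixpoint lebesgue_cV n : {sigma_finite_measure set 'cV[R]_n -> \bar R} :=
  match n with
  | 0 => dirac (0 : 'cV[R]_0)
  | n'.+1 => lebesgue_cV_step (lebesgue_cV n')
  end.

Lemma lebesgue_cV_box n (A : 'I_n -> set R) : (forall i, measurable (A i)) ->
  lebesgue_cV n [set x | forall i, A i (x i 0)] =
  (\prod_(i < n) lebesgue_measure (A i))%E.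
Proof.
elim: n A => [|n IH] A mA /=.
  rewrite big_ord0 diracE mem_set//= => -[].
  by case.
rewrite big_ord_recl -IH; last by move=> i; exact: mA.
pose B := [set x : 'cV[R]_n | forall i, A (lift ord0 i) (x i 0)].
have mB : measurable B.
  rewrite (_ : B = \bigcap_(i in [set: 'I_n])
      ((fun x : 'cV[R]_n => x i 0) @^-1` A (lift ord0 i))).
    apply: fin_bigcap_measurable; first exact: finite_finset.
    move=> i _; rewrite -[X in measurable X]setTI.
    exact: (@measurable_entry _ _ n 1 i 0).
  by apply/seteqP; split => x /= h i; [move=> _|]; exact: h.
transitivity ((@lebesgue_measure R \x lebesgue_cV n)%E (A ord0 `*` B));
  last exact: (product_measure1E (@lebesgue_measure R) (lebesgue_cV n)
    (mA ord0 : measurable (A ord0 : set (measurableTypeR R))) mB).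
congr product_measure1.
apply/seteqP; split => p /=.
- move=> h; split; first by have := h ord0; rewrite cons_cV0.
  by move=> i; have := h (lift ord0 i); rewrite cons_cVS.
- move=> [h0 h] i; have [k ->|->] := unliftP ord0 i.
  + by rewrite cons_cVS.
  + by rewrite cons_cV0.
Qed.

End lebesgue_cV.

Section euclidean.
Context {R : realType}.

Definition dotv n (u v : 'cV[R]_n) : R := \sum_(i < n) u i 0 * v i 0.

(* Euclidean norm; the library norm [`|v|] on matrices is the sup norm. *)
Definition enorm n (v : 'cV[R]_n) : R := Num.sqrt (\sum_(i < n) v i 0 ^+ 2).

Definition opnorm m n (A : 'M[R]_(m, n)) : R :=
  sup [set enorm (A *m v) | v in [set v : 'cV[R]_n | enorm v <= 1]].

Definition intrinsic_dim n (A : 'M[R]_n) : R := \tr A / opnorm A.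

End euclidean.

(* [gradient_on D f gf]: the function f on D, with D an arbitrary subset of
   R^d, is differentiable at every point x of D, with gradient gf x there. Only
   the values of f on D are involved (y tends to x within D), and the sup norm
   of y - x could be replaced by any other norm of R^d; when D is open this is
   the library's differentiability, see [gradient_on_open]. *)
Definition gradient_on {R : realType} d (D : set 'cV[R]_d)
    (f : 'cV[R]_d -> R) (gf : 'cV[R]_d -> 'cV[R]_d) : Prop :=
  forall x, D x -> forall eps : R, 0 < eps ->
    \forall y \near x, D y ->
      `|f y - f x - dotv (gf x) (y - x)| <= eps * `|y - x|.

Lemma gradient_on_open {R : realType} d (D : set 'cV[R]_d)
    (f : 'cV[R]_d -> R^o) (gf : 'cV[R]_d -> 'cV[R]_d) : open D ->
  gradient_on D f gf <->
  forall x, D x -> differentiable f x /\ forall h, 'd f x h = dotv (gf x) h.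
Proof.
move=> oD; split=> [gfP x Dx|dfP x Dx e e0].
- pose L (h : 'cV[R]_d) : R^o := dotv (gf x) h.
  have Llin : linear L.
    move=> a u v; rewrite /L /dotv scaler_sumr -big_split/=; apply: eq_bigr.
    by move=> i _; rewrite !mxE mulrDr; congr (_ + _); rewrite mulrCA.
  pose Lm := GRing.isLinear.Build R 'cV[R]_d R^o _ L Llin.
  pose LL : {linear 'cV[R]_d -> R^o} := HB.pack L Lm.
  have Lc : continuous LL.
    rewrite /LL/= /L /dotv; apply: continuous_big; first exact: add_continuous.
    move=> i _ h.
    apply: (@continuous_comp _ _ _ (fun M : 'cV[R]_d => M i 0)).
      exact: coord_continuous.
    exact: mulrl_continuous.
  have fE : f \o shift x = cst (f x : R^o) + LL +o_ (0 : 'cV[R]_d) id.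
    apply/(@eqaddoP _ _ R^o _) => e e0.
    have xD : \forall y \near x, D y by exact: open_nbhs_nbhs.
    have : \forall y \near x,
        `|f y - f x - dotv (gf x) (y - x)| <= e * `|y - x|.
      by apply: filterS2 xD (gfP x Dx e e0) => y Dy; apply.
    rewrite [\forall y \near x, _ <= _](near_shift (0 : 'cV[R]_d)) subr0.
    by apply: filterS => h /=; rewrite addrK opprD addrA.
  have dE := diff_unique Lc fE.
  split; last by move=> h; rewrite dE.
  by apply/diff_locallyP; rewrite dE.
- have [dfx dE] := dfP x Dx.
  have [_ /eqaddoP/(_ e e0) H] := (diff_locallyP _ _).1 dfx.
  rewrite [\forall y \near x, _](near_shift (0 : 'cV[R]_d)) subr0.
  apply: filterS H => h /= + _; rewrite addrK -dE !fctE.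
  by rewrite opprD addrA.
Qed.

Section probability_notions.
Context {R : realType} {disp : measure_display} {Omega : measurableType disp}
  (P : probability Omega R).

Definition density_on d (D : set 'cV[R]_d) (rho : 'cV[R]_d -> R) : Prop :=
  [/\ measurable_fun D rho, (forall x, D x -> 0 <= rho x) &
      (\int[lebesgue_cV d]_(x in D) (rho x)%:E = 1)%E].

Definition has_density d (D : set 'cV[R]_d) (rho : 'cV[R]_d -> R)
    (X : {RV P >-> 'cV[R]_d}) : Prop :=
  (forall w, D (X w)) /\
  forall A : set 'cV[R]_d, measurable A ->
    (P (X @^-1` A) = \int[lebesgue_cV d]_(x in D `&` A) (rho x)%:E)%E.

Definition square_integrable_on d (D : set 'cV[R]_d) (rho : 'cV[R]_d -> R)
    (h : 'cV[R]_d -> R) : Prop :=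
  measurable_fun D h /\
  (\int[lebesgue_cV d]_(x in D) (h x ^+ 2 * rho x)%:E < +oo)%E.

Definition mutually_independent {dispT} {T : measurableType dispT} n
    (Y : 'I_n -> {RV P >-> T}) : Prop :=
  forall A : 'I_n -> set T, (forall i, measurable (A i)) ->
    (P (\bigcap_(i in [set: 'I_n]) (Y i @^-1` A i)) =
     \prod_(i < n) P (Y i @^-1` A i))%E.

Definition independent_copies d (D : set 'cV[R]_d) (X : {RV P >-> 'cV[R]_d}) n
    (Y : 'I_n -> {RV P >-> 'cV[R]_d}) : Prop :=
  [/\ (forall i w, D (Y i w)),
      (forall i (A : set 'cV[R]_d), measurable A ->
         P (Y i @^-1` A) = P (X @^-1` A)) &
      mutually_independent Y].

Definition expectation_mx m n (M : Omega -> 'M[R]_(m, n)) : 'M[R]_(m, n) :=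
  \matrix_(i, j) fine ('E_P[fun w => M w i j])%E.

Definition active_subspace_mx d (gf : 'cV[R]_d -> 'cV[R]_d)
    (X : {RV P >-> 'cV[R]_d}) : 'M[R]_d :=
  expectation_mx (fun w => gf (X w) *m (gf (X w))^T).

(* The first m1 samples are indexed by [lshift m2 i], the last m2 ones by
   [rshift m1 i]. *)
Definition mf_estimator d (gf gg : 'cV[R]_d -> 'cV[R]_d) m1 m2
    (Y : 'I_(m1 + m2) -> {RV P >-> 'cV[R]_d}) (w : Omega) : 'M[R]_d :=
  m1%:R^-1 *: (\sum_(i < m1)
     (let x := Y (lshift m2 i) w in gf x *m (gf x)^T - gg x *m (gg x)^T))
  + m2%:R^-1 *: (\sum_(i < m2)
     (let x := Y (rshift m1 i) w in gg x *m (gg x)^T)).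

End probability_notions.

(* Main.v *)
Require Import Defs.
From HB Require Import structures.
From mathcomp Require Import all_boot all_order all_algebra.
From mathcomp Require Import all_classical all_reals all_analysis.
From mathcomp Require Import measurable_realfun ring lra.

(** Write T = E |grad f|^2 = delta_H ||H||, a = grad f and b = grad g. The error
    H - Hmf is a sum of m1 + m2 independent centred symmetric matrices, one for
    each sample: (E M - M(X_i)) / m1 with M = a a^T - b b^T for the first m1
    samples, and (E M - M(X_i)) / m2 with M = b b^T for the others. Since
    a a^T - b b^T is the symmetric part of (a - b) (a + b)^T, the closeness of
    the gradients makes the first kind small: ||M|| <= theta (2 beta + theta) T
    and E |M u|^2 <= theta^2 (2 + theta)^2 T^2 |u|^2. The second kind has no
    such gain, but the lower bound on m2 says exactly that it contributes no
    more than the first kind, both to the uniform bound and to the variance.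
    Hence both claims are the matrix Bernstein inequalities in expectation and
    in probability, with variance v = 2 theta^2 (2 + theta)^2 T^2 / m1 and
    uniform bound L = 2 theta (2 beta + theta) T / m1 (the two groups double
    the variance, centring doubles the uniform bound), once the conditions on
    m1 are read as conditions on v and L (expectation_sample_size,
    tail_sample_size).

    The samples of each group have the same law, so that Bernstein's inequality
    is only needed with the sum of the norms of the second moments as variance.
    For this the Golden-Thompson inequality suffices: the summands are peeled
    off one at a time from E tr exp(t Z).

    The exponential is replaced throughout by (1 + A / n)^n with n a power of
    two, which makes every step polynomial.
    - For symmetric X and Y and n a power of two,
      tr (X Y)^n <= tr (X^n Y^n) (mxtrace_pow2_ineqs); with X = 1 + A / n and
      Y = 1 + S / n this is Golden-Thompson up to O(1 / n)
      (euler_mx_golden_thompson).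
    - If ||S|| <= L < 3, then as a quadratic form (1 + S / n)^n is at most
      1 + S + g S^2 with g = 1 / (2 (1 - L / 3)), by expanding and bounding
      S^(i+2) by L^i S^2 (euler_mx_quadratic). No diagonalisation is involved.
    - Conversely tr (1 + Z / n)^n + tr (1 - Z / n)^n dominates
      (1 + |Z u| / n)^n for every unit vector u, by comparing even powers
      (euler_mx_trace_ge).
    - The entries of (1 + Z / n)^n are sums of products of bounded functions of
      single samples, so that independence from the next summand is the product
      rule for such products (indep_Ex_prod, past_indep).
    Induction on the number of summands (Ex_euler_sum_le) and n tending to
    infinity give E exp(t ||Z||) <= 2 d exp(g t^2 v) with t L in place of L in g
    (Ex_expR_opnorm_le applied to t Z), from which Markov's inequality and the
    tangent line of the logarithm give bernstein_tail and
    bernstein_expectation.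

    The gradients are bounded only almost surely and only on the domain; they
    are first set to 0 outside the set where the bounds hold. The finiteness of
    T comes from the square integrability against the density
    (density_second_moment). *)

Set Implicit Arguments.
Unset Strict Implicit.
Unset Printing Implicit Defensive.

Import Order.TTheory GRing.Theory Num.Theory.
Import numFieldNormedType.Exports.

Local Open Scope classical_set_scope.
Local Open Scope ring_scope.

(** * Euclidean vectors and operator bounds *)

Section dot_product.
Context {R : realType} {d : nat}.
Implicit Types (u v w : 'cV[R]_d) (A B : 'M[R]_d) (c : R).

Lemma dotvC u v : dotv u v = dotv v u.
Proof. by apply: eq_bigr => i _; rewrite mulrC. Qed.

Lemma dotvDr u v w : dotv u (v + w) = dotv u v + dotv u w.
Proof.
by rewrite /dotv -big_split; apply: eq_bigr => i _; rewrite /= mxE mulrDr.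
Qed.

Lemma dotvDl u v w : dotv (v + w) u = dotv v u + dotv w u.
Proof. by rewrite dotvC dotvDr !(dotvC u). Qed.

Lemma dotvZr c u v : dotv u (c *: v) = c * dotv u v.
Proof.
by rewrite /dotv mulr_sumr; apply: eq_bigr => i _; rewrite mxE mulrCA.
Qed.

Lemma dotvZl c u v : dotv (c *: u) v = c * dotv u v.
Proof. by rewrite dotvC dotvZr dotvC. Qed.

Lemma dotvNr u v : dotv u (- v) = - dotv u v.
Proof. by rewrite -scaleN1r dotvZr mulN1r. Qed.

Lemma dotvNl u v : dotv (- u) v = - dotv u v.
Proof. by rewrite dotvC dotvNr dotvC. Qed.

Lemma dotv0 u : dotv u 0 = 0.
Proof. by rewrite -(scale0r 0) dotvZr mul0r. Qed.

Lemma dotv_sumr I (r : seq I) (p : pred I) (F : I -> 'cV[R]_d) u :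
  dotv u (\sum_(i <- r | p i) F i) = \sum_(i <- r | p i) dotv u (F i).
Proof. by elim/big_rec2: _ => [|i x y _ <-]; rewrite ?dotv0// dotvDr. Qed.

Lemma dotv_mulmx A u v : dotv u (A *m v) = dotv (A^T *m u) v.
Proof.
rewrite /dotv; under eq_bigr do rewrite mxE mulr_sumr.
rewrite exchange_big; apply: eq_bigr => i _; rewrite mxE mulr_suml.
by apply: eq_bigr => j _; rewrite mxE; ring.
Qed.

Lemma dotv_ge0 u : 0 <= dotv u u.
Proof. by apply: sumr_ge0 => i _; rewrite -expr2 sqr_ge0. Qed.

Lemma enorm_ge0 u : 0 <= enorm u.
Proof. exact: sqrtr_ge0. Qed.

Lemma enorm_sqr u : enorm u ^+ 2 = dotv u u.
Proof.
by rewrite sqr_sqrtr ?sumr_ge0// => *; rewrite sqr_ge0.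
Qed.

Lemma enorm0 : enorm (0 : 'cV[R]_d) = 0.
Proof. by apply/eqP; rewrite -sqrf_eq0 enorm_sqr dotv0. Qed.

Lemma cauchy_schwarz_sqr u v : dotv u v ^+ 2 <= dotv u u * dotv v v.
Proof.
have [v0|v0] := eqVneq (dotv v v) 0.
  have [uv0|uv0] := eqVneq (dotv u v) 0; first by rewrite uv0 v0; lra.
  (* a linear function of t that is bounded below must be constant *)
  pose t := - (dotv u u + 1) / (2 * dotv u v).
  have := dotv_ge0 (u + t *: v).
  rewrite dotvDl !dotvDr !dotvZl !dotvZr v0 (dotvC v u).
  have -> : dotv u u + t * dotv u v + (t * dotv u v + t * (t * 0)) = -1.
    by rewrite /t; field.
  lra.
have v_gt0 : 0 < dotv v v by rewrite lt_def v0 dotv_ge0.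
have := dotv_ge0 (dotv v v *: u - dotv u v *: v).
rewrite dotvDl !dotvDr !dotvNl !dotvNr !dotvZl !dotvZr (dotvC v u) => h.
rewrite -subr_ge0 -(pmulr_rge0 _ v_gt0); apply: le_trans h _.
by rewrite le_eqVlt; apply/orP; left; apply/eqP; ring.
Qed.

Lemma cauchy_schwarz u v : `|dotv u v| <= enorm u * enorm v.
Proof.
rewrite -(@ler_pXn2r _ 2)// ?nnegrE ?mulr_ge0 ?enorm_ge0//.
by rewrite exprMn !enorm_sqr real_normK ?num_real// cauchy_schwarz_sqr.
Qed.

Lemma enormD u v : enorm (u + v) <= enorm u + enorm v.
Proof.
rewrite -(@ler_pXn2r _ 2)// ?nnegrE ?addr_ge0 ?enorm_ge0//.
rewrite sqrrD !enorm_sqr dotvDl !dotvDr (dotvC v u).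
have := le_trans (ler_norm _) (cauchy_schwarz u v); lra.
Qed.

Lemma enormZ c u : enorm (c *: u) = `|c| * enorm u.
Proof.
apply/eqP; rewrite -(@eqrXn2 _ 2)// ?mulr_ge0 ?enorm_ge0//.
by rewrite exprMn !enorm_sqr dotvZl dotvZr real_normK ?num_real// mulrA -expr2.
Qed.

Lemma enormN u : enorm (- u) = enorm u.
Proof. by rewrite -scaleN1r enormZ normrN1 mul1r. Qed.

Lemma enorm_eq0 u : (enorm u == 0) = (u == 0).
Proof.
apply/idP/eqP => [|->]; last by rewrite enorm0.
rewrite -sqrf_eq0 enorm_sqr /dotv psumr_eq0; last first.
  by move=> i _; rewrite -expr2 sqr_ge0.
move=> /allP u0; apply/colP => i; rewrite mxE.
by have /eqP := u0 i (mem_index_enum _); rewrite -expr2 => /eqP; rewrite sqrf_eq0 => /eqP.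
Qed.

Lemma enorm_delta i : enorm (delta_mx i 0 : 'cV[R]_d) = 1.
Proof.
apply/eqP; rewrite -(@eqrXn2 _ 2)// ?enorm_ge0// enorm_sqr expr1n.
rewrite /dotv (bigD1 i)//= big1 => [|j ji]; first by rewrite !mxE !eqxx mulr1 addr0.
by rewrite !mxE (negPf ji) mul0r.
Qed.

Lemma dotv_delta i u : dotv (delta_mx i 0) u = u i 0.
Proof.
rewrite /dotv (bigD1 i)//= big1 => [|j ji]; first by rewrite !mxE !eqxx mul1r addr0.
by rewrite !mxE (negPf ji) mul0r.
Qed.

Lemma entry_enorm i u : `|u i 0| <= enorm u.
Proof.
rewrite -dotv_delta; apply: le_trans (cauchy_schwarz _ _) _.
by rewrite enorm_delta mul1r.
Qed.

End dot_product.

Section operator_bound.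
Context {R : realType} {d : nat}.
Implicit Types (u v w : 'cV[R]_d) (A B P Q : 'M[R]_d) (c : R).

(** An upper bound on the operator norm, stated without a supremum, so that
    it is manifestly stable under sums and products. *)
Definition opbound A c := forall u, enorm (A *m u) <= c * enorm u.

Lemma opbound_le A c c' : c <= c' -> opbound A c -> opbound A c'.
Proof.
by move=> cc' h u; apply: le_trans (h u) _; rewrite ler_wpM2r ?enorm_ge0.
Qed.

Lemma opbound1 : opbound 1 1.
Proof. by move=> u; rewrite mul1r mul1mx. Qed.

Lemma opbound0 : opbound 0 0.
Proof. by move=> u; rewrite mul0r mul0mx enorm0. Qed.

Lemma opboundD A B a b : opbound A a -> opbound B b -> opbound (A + B) (a + b).
Proof.
move=> hA hB u; rewrite mulmxDl mulrDl.
by apply: le_trans (enormD _ _) _; rewrite lerD.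
Qed.

Lemma opboundZ c A a : opbound A a -> opbound (c *: A) (`|c| * a).
Proof. by move=> hA u; rewrite -scalemxAl enormZ -mulrA ler_wpM2l. Qed.

Lemma opboundN A a : opbound A a -> opbound (- A) a.
Proof. by move=> hA u; rewrite mulNmx enormN. Qed.

Lemma opbound_sum I (r : seq I) (F : I -> 'M[R]_d) (a : I -> R) :
  (forall i, opbound (F i) (a i)) ->
  opbound (\sum_(i <- r) F i) (\sum_(i <- r) a i).
Proof.
move=> h; elim/big_rec2: _ => [|i x y _]; first exact: opbound0.
exact: opboundD.
Qed.

Lemma opboundM A B a b : 0 <= a ->
  opbound A a -> opbound B b -> opbound (A * B) (a * b).
Proof.
move=> a0 hA hB u; rewrite -mulmxE -mulmxA -mulrA.
by apply: le_trans (hA _) _; rewrite ler_wpM2l.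
Qed.

Lemma opboundX A a n : 0 <= a -> opbound A a -> opbound (A ^+ n) (a ^+ n).
Proof.
move=> a0 hA; elim: n => [|n IH]; first by rewrite !expr0; exact: opbound1.
by rewrite !exprS; exact: opboundM.
Qed.

Lemma opbound_entry A a i j : opbound A a -> `|A i j| <= a.
Proof.
move=> hA; have := hA (delta_mx j 0).
rewrite -colE enorm_delta mulr1; apply: le_trans.
by have -> : A i j = col j A i 0; [rewrite mxE | exact: entry_enorm].
Qed.

Lemma opbound_trace A a : opbound A a -> `|\tr A| <= d%:R * a.
Proof.
move=> hA; apply: le_trans (ler_norm_sum _ _ _) _.
rewrite mulr_natl -[d in _ *+ d]card_ord -sumr_const.
by apply: ler_sum => i _; exact: opbound_entry.
Qed.

(** Telescoping, one factor at a time, from P^n to Q^n. *)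
Lemma opbound_subX P Q r e n : 1 <= r -> 0 <= e ->
  opbound P r -> opbound Q r -> opbound (P - Q) e ->
  opbound (P ^+ n - Q ^+ n) (n%:R * r ^+ n * e).
Proof.
move=> r1 e0 hP hQ hPQ; have r0 : 0 <= r by lra.
elim: n => [|n IH]; first by rewrite !expr0 subrr !mul0r; exact: opbound0.
have -> : P ^+ n.+1 - Q ^+ n.+1 = P * (P ^+ n - Q ^+ n) + (P - Q) * Q ^+ n.
  by rewrite mulrBr mulrBl -!exprS addrA subrK.
have := opboundD (opboundM r0 hP IH) (opboundM e0 hPQ (opboundX n r0 hQ)).
apply: opbound_le.
have : e * r ^+ n <= e * r ^+ n.+1 by rewrite ler_wpM2l// exprS ler_peMl// exprn_ge0.
rewrite -natr1 exprS; nra.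
Qed.

End operator_bound.

(** * Trace inequalities for powers of two *)

Section trace_inequality.
Context {R : realType} {d : nat}.
Implicit Types (A B M X Y : 'M[R]_d).

Lemma trmxX A n : (A ^+ n)^T = A^T ^+ n.
Proof.
elim: n => [|n IH]; first by rewrite !expr0 trmx1.
by rewrite exprS exprSr -!mulmxE trmx_mul IH.
Qed.

Lemma mxtrace_mulrC A B : \tr (A * B) = \tr (B * A).
Proof. by rewrite -!mulmxE mxtrace_mulC. Qed.

Lemma mxtrace_mulX A B n : \tr ((A * B) ^+ n) = \tr ((B * A) ^+ n).
Proof.
have mulX m : (A * B) ^+ m.+1 = A * (B * A) ^+ m * B.
  elim: m => [|m IH]; first by rewrite expr0 expr1 mulr1.
  by rewrite exprS IH exprS !mulrA.
case: n => [|n]; first by rewrite !expr0.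
by rewrite mulX mxtrace_mulrC mulrA -exprS.
Qed.

Lemma mxtrace_mul_sum A B : \tr (A * B) = \sum_i \sum_j A i j * B j i.
Proof. by apply: eq_bigr => i _; rewrite -mulmxE mxE. Qed.

Lemma mxtrace_sqr_tr A : \tr (A * A^T) = \sum_i \sum_j A i j ^+ 2.
Proof.
rewrite mxtrace_mul_sum; apply: eq_bigr => i _; apply: eq_bigr => j _.
by rewrite mxE expr2.
Qed.

Lemma mxtrace_mul_le A B :
  \tr (A * B) <= (\tr (A * A^T) + \tr (B * B^T)) / 2.
Proof.
rewrite mxtrace_mul_sum !mxtrace_sqr_tr [X in _ + X]exchange_big /=.
rewrite -big_split /= mulr_suml; apply: ler_sum => i _.
rewrite -big_split /= mulr_suml; apply: ler_sum => j _.
have := sqr_ge0 (A i j - B j i); rewrite sqrrB; lra.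
Qed.

(** The two inequalities feed each other: squaring M turns M M^T into
    M (M M^T) M^T, whose powers have the same trace as those of the product
    of the two symmetric matrices M^T M and M M^T. *)
Lemma mxtrace_pow2_ineqs k :
  (forall M, \tr (M ^+ (2 ^ k.+1)) <= \tr ((M * M^T) ^+ (2 ^ k))) /\
  (forall X Y, X^T = X -> Y^T = Y ->
     \tr ((X * Y) ^+ (2 ^ k)) <= \tr (X ^+ (2 ^ k) * Y ^+ (2 ^ k))).
Proof.
elim: k => [|k [IHM IHXY]].
  split=> [M|X Y _ _]; last by rewrite !expn0 !expr1.
  rewrite expn1 expn0 expr1 expr2; apply: le_trans (mxtrace_mul_le _ _) _.
  by lra.
have split2 M : M ^+ (2 ^ k.+1) = (M * M) ^+ (2 ^ k).
  by rewrite expnS exprM expr2.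
split=> [M|X Y symX symY].
- have -> : M ^+ (2 ^ k.+2) = (M * M) ^+ (2 ^ k.+1).
    by rewrite [in LHS]expnS exprM expr2.
  apply: le_trans (IHM _) _.
  have -> : \tr ((M * M * (M * M)^T) ^+ (2 ^ k)) =
            \tr ((M * M^T * (M^T * M)) ^+ (2 ^ k)).
    have -> : M * M * (M * M)^T = M * (M * M^T * M^T).
      by rewrite -!mulmxE trmx_mul !mulmxA.
    by rewrite mxtrace_mulX !mulrA.
  apply: le_trans (IHXY _ _ _ _) _; rewrite -?mulmxE ?trmx_mul ?trmxK//.
  rewrite !mulmxE; apply: le_trans (mxtrace_mul_le _ _) _.
  rewrite !trmxX -!mulmxE !trmx_mul !trmxK !mulmxE -!expr2 -!exprM mulnC -expnS.
  by rewrite [\tr ((M^T * M) ^+ _)]mxtrace_mulX; lra.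
- apply: le_trans (IHM _) _; rewrite -mulmxE trmx_mul symX symY !mulmxE.
  have -> : X * Y * (Y * X) = X * (Y * Y * X) by rewrite !mulrA.
  rewrite mxtrace_mulX -mulrA mxtrace_mulX.
  apply: le_trans (IHXY _ _ _ _) _; rewrite -?mulmxE ?trmx_mul ?symX ?symY//.
  by rewrite !split2 mulmxE.
Qed.

End trace_inequality.

(** * The power (1 + A / n)^n as a substitute for the exponential *)

Section euler_power.
Context {R : realType}.

Definition euler_coef (n i : nat) : R := 'C(n, i)%:R / n%:R ^+ i.

Lemma euler_coef_ge0 n i : 0 <= euler_coef n i.
Proof. by rewrite divr_ge0// exprn_ge0. Qed.

Lemma euler_coef0 n : euler_coef n 0 = 1.
Proof. by rewrite /euler_coef bin0 expr0 divr1. Qed.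

Lemma euler_coef1 n : (0 < n)%N -> euler_coef n 1 = 1.
Proof. by move=> n0; rewrite /euler_coef bin1 expr1 divff// pnatr_eq0 -lt0n. Qed.

(** The coefficient is at most 1 / (i + 2)!, and (i + 2)! >= 2 * 3 ^ i. *)
Lemma euler_coefSS_le n i : (0 < n)%N -> euler_coef n i.+2 <= 2^-1 * 3^-1 ^+ i.
Proof.
move=> n0; have ffact_le m : (n ^_ m <= n ^ m)%N.
  elim: m => // m IH; rewrite ffactnSr expnSr leq_mul// leq_subr//.
have fact_ge : (2 * 3 ^ i <= (i.+2)`!)%N.
  elim: i => // j IH; rewrite factS expnS mulnCA leq_mul//.
rewrite /euler_coef ler_pdivrMr ?exprn_gt0 ?ltr0n//.
rewrite exprVn -invfM mulrC ler_pdivlMr ?mulr_gt0 ?exprn_gt0//.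
rewrite -!natrX -!natrM ler_nat.
apply: leq_trans (ffact_le i.+2); rewrite -bin_ffact leq_mul2l.
by rewrite fact_ge orbT.
Qed.

Lemma euler_expand1 (n : nat) (x : R) :
  (1 + x / n%:R) ^+ n = \sum_(i < n.+1) euler_coef n i * x ^+ i.
Proof.
rewrite addrC exprD1n; apply: eq_bigr => i _.
by rewrite expr_div_n -mulr_natl /euler_coef mulrA mulrAC.
Qed.

Context {d : nat}.
Implicit Types (A S Z : 'M[R]_d) (u w : 'cV[R]_d).

(** The power that tends to exp A when n tends to infinity. *)
Definition euler_mx n A : 'M[R]_d := (1 + n%:R^-1 *: A) ^+ n.

Lemma euler_mx_expand n A :
  euler_mx n A = \sum_(i < n.+1) euler_coef n i *: A ^+ i.
Proof.
rewrite /euler_mx addrC exprD1n; apply: eq_bigr => i _.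
have -> : (n%:R^-1 *: A) ^+ i = n%:R^-1 ^+ i *: A ^+ i.
  elim: (val i) => [|j IH]; first by rewrite !expr0 scale1r.
  by rewrite !exprS IH -!mulmxE -scalemxAl -scalemxAr scalerA.
by rewrite scalerMnl -mulr_natl /euler_coef exprVn.
Qed.

(** Since S is symmetric, w . S^(i+2) w = S w . S^i (S w) <= L^i |S w|^2:
    every term of degree at least two of the expansion is controlled by the
    term of degree two, with a geometric series of ratio L / 3. *)
Lemma euler_mx_quadratic n S (L : R) w : (0 < n)%N -> S^T = S ->
  0 <= L -> L < 3 -> opbound S L ->
  dotv w (euler_mx n S *m w) <=
  dotv w w + dotv w (S *m w)
  + (2 * (1 - L / 3))^-1 * dotv (S *m w) (S *m w).
Proof.
move=> n0 symS L0 L3 hS; rewrite euler_mx_expand.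
rewrite big_ord_recl euler_coef0 scale1r expr0 mulmxDl mul1mx dotvDr -addrA lerD2l.
case: n n0 => // n _.
rewrite big_ord_recl lift0 euler_coef1// scale1r expr1 mulmxDl dotvDr lerD2l.
rewrite mulmx_suml dotv_sumr.
have term (i : 'I_n) : dotv w (euler_coef n.+1 (lift ord0 (lift ord0 i)) *:
    S ^+ lift ord0 (lift ord0 i) *m w) <=
    2^-1 * (L / 3) ^+ i * dotv (S *m w) (S *m w).
  rewrite !lift0 -scalemxAl dotvZr exprS exprSr -!mulmxE -!mulmxA.
  rewrite dotv_mulmx symS exprMn mulrA -[leRHS]mulrA.
  have hq : `|dotv (S *m w) (S ^+ i *m (S *m w))| <=
      L ^+ i * dotv (S *m w) (S *m w).
    apply: le_trans (cauchy_schwarz _ _) _; rewrite -enorm_sqr.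
    by rewrite expr2 mulrCA ler_wpM2l ?enorm_ge0// opboundX.
  have {}hq := le_trans (ler_norm _) hq.
  apply: (le_trans (ler_wpM2l (euler_coef_ge0 n.+1 i.+2) hq)).
  rewrite !mulrA ler_wpM2r ?dotv_ge0// [leRHS]mulrAC ler_wpM2r ?exprn_ge0//.
  exact: euler_coefSS_le.
apply: le_trans (ler_sum _ (fun i _ => term i)) _.
rewrite -mulr_suml ler_wpM2r ?dotv_ge0// -mulr_sumr invfM ler_wpM2l//.
have r0 : 0 < 1 - L / 3 by lra.
rewrite -[leRHS]mul1r ler_pdivlMr// mulrC.
have -> : (1 - L / 3) * \sum_(i < n) (L / 3) ^+ i = 1 - (L / 3) ^+ n.
  have /(congr1 -%R) := subrX1 (L / 3) n.
  by rewrite opprB => ->; rewrite -mulNr opprB.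
by rewrite gerBl exprn_ge0// divr_ge0.
Qed.

Lemma enorm_mul_le_frobenius A u : enorm (A *m u) ^+ 2 <= \tr (A * A^T) * dotv u u.
Proof.
rewrite mxtrace_sqr_tr enorm_sqr mulr_suml; apply: ler_sum => i _.
have := cauchy_schwarz_sqr (row i A)^T u.
have -> : dotv (row i A)^T u = (A *m u) i 0.
  by rewrite mxE; apply: eq_bigr => j _; rewrite !mxE.
rewrite expr2 => /le_trans; apply; rewrite le_eqVlt; apply/orP; left.
by apply/eqP; congr (_ * _); apply: eq_bigr => j _; rewrite !mxE expr2.
Qed.

(** The sequence |Z^j u| is log-convex, by Cauchy-Schwarz and the symmetry
    of Z. *)
Lemma enorm_symX_ge Z u j : Z^T = Z -> enorm u = 1 ->
  enorm (Z *m u) ^+ j <= enorm (Z ^+ j *m u).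
Proof.
move=> symZ u1.
have logconvex i : enorm (Z ^+ i.+1 *m u) ^+ 2 <=
    enorm (Z ^+ i *m u) * enorm (Z ^+ i.+2 *m u).
  rewrite enorm_sqr {1}exprS -mulmxE -mulmxA -{1}symZ -dotv_mulmx.
  apply: le_trans (ler_norm _) _; apply: le_trans (cauchy_schwarz _ _) _.
  by rewrite mulmxA mulmxE -exprS.
have ratio i : enorm (Z *m u) * enorm (Z ^+ i *m u) <= enorm (Z ^+ i.+1 *m u).
  elim: i => [|i IH]; first by rewrite expr0 mul1mx u1 mulr1 expr1.
  have a0 := enorm_ge0 (Z ^+ i *m u).
  have b0 := enorm_ge0 (Z ^+ i.+1 *m u).
  have c0 := enorm_ge0 (Z ^+ i.+2 *m u).
  have [ai0|ai0] := eqVneq (enorm (Z ^+ i *m u)) 0.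
    have := logconvex i; rewrite ai0 mul0r => h.
    suff -> : enorm (Z ^+ i.+1 *m u) = 0 by rewrite mulr0.
    by apply/eqP; rewrite -sqrf_eq0 eq_le h sqr_ge0.
  have a_gt0 : 0 < enorm (Z ^+ i *m u) by rewrite lt_def ai0.
  rewrite -(ler_pM2l a_gt0); apply: le_trans (logconvex i).
  by rewrite mulrA [_ * enorm (Z *m u)]mulrC expr2 ler_wpM2r.
elim: j => [|j IH]; first by rewrite !expr0 mul1mx u1.
by rewrite exprS; apply: le_trans (ratio j); rewrite ler_wpM2l ?enorm_ge0.
Qed.

(** The trace of Z^(2j) is the squared Frobenius norm of Z^j. *)
Lemma mxtrace_sym_even_ge Z u j : Z^T = Z -> enorm u = 1 ->
  enorm (Z *m u) ^+ j.*2 <= \tr (Z ^+ j.*2).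
Proof.
move=> symZ u1; rewrite -addnn !exprD -expr2.
have := enorm_mul_le_frobenius (Z ^+ j) u.
rewrite -enorm_sqr u1 expr1n mulr1 trmxX symZ; apply: le_trans.
by rewrite lerXn2r ?nnegrE ?exprn_ge0 ?enorm_ge0// enorm_symX_ge.
Qed.

(** Adding the expansions for Z and - Z leaves twice the even powers, whose
    traces dominate the powers of |Z u|. *)
Lemma euler_mx_trace_ge n Z u : ~~ odd n -> Z^T = Z -> enorm u = 1 ->
  (1 + enorm (Z *m u) / n%:R) ^+ n <=
  \tr (euler_mx n Z) + \tr (euler_mx n (- Z)).
Proof.
move=> n_even symZ u1; have := fun j => mxtrace_sym_even_ge j symZ u1.
move: (enorm (Z *m u)) => s hs.
apply: (@le_trans _ _ ((1 + s / n%:R) ^+ n + (1 + (- s) / n%:R) ^+ n)).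
  by rewrite lerDl -(even_halfK n_even) -muln2 exprM sqr_ge0.
rewrite !euler_expand1 !euler_mx_expand !raddf_sum /= -!big_split /=.
apply: ler_sum => i _; rewrite !mxtraceZ -!mulrDr ler_wpM2l ?euler_coef_ge0//.
rewrite (exprNn s i) (exprNn Z i) -!(signr_odd _ i).
have [i_odd|i_even] := boolP (odd i).
  by rewrite !expr1 !mulN1r linearN /= !subrr.
rewrite !expr0 !mul1r.
by have := hs i./2; rewrite (even_halfK i_even); lra.
Qed.

(** The factors (1 + A / n) (1 + S / n) and 1 + (A + S) / n differ by
    A S / n^2, so that their n-th powers differ by O(1 / n). *)
Lemma euler_mx_golden_thompson n k A S (C : R) : n = (2 ^ k)%N -> 0 <= C ->
  A^T = A -> S^T = S -> opbound A C -> opbound S C ->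
  \tr (euler_mx n (A + S)) <=
  \tr (euler_mx n A * euler_mx n S)
  + d%:R * (C ^+ 2 * expR (2 * C)) * n%:R^-1.
Proof.
move=> nE C0 symA symS hA hS.
have n_gt0 : 0 < n%:R :> R by rewrite nE ltr0n expn_gt0.
set c := n%:R^-1; have c0 : 0 <= c by rewrite invr_ge0 ltW.
set P := 1 + c *: (A + S); set X := 1 + c *: A; set Y := 1 + c *: S.
have hX (B : 'M[R]_d) : opbound B C -> opbound (1 + c *: B) (1 + c * C).
  move=> hB; apply: opboundD; first exact: opbound1.
  by have := opboundZ c hB; rewrite ger0_norm.
have r1 : 1 <= (1 + c * C) ^+ 2 by have := mulr_ge0 c0 C0; nra.
have PXY : P - X * Y = - (c ^+ 2 *: (A * S)).
  rewrite /P /X /Y mulrDl mul1r mulrDr mulr1.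
  rewrite -!mulmxE -scalemxAl -scalemxAr scalerA -expr2 scalerDr.
  move: (c *: A) (c *: S) (c ^+ 2 *: _) (1 : 'M[R]_d) => U V W I.
  by apply/matrixP => i j; rewrite !mxE; ring.
have cC0 : 0 <= c * C by rewrite mulr_ge0.
have hP : opbound P ((1 + c * C) ^+ 2).
  apply: opbound_le (opboundD opbound1 (opboundZ c (opboundD hA hS))).
  by rewrite ger0_norm//; nra.
have hXY : opbound (X * Y) ((1 + c * C) ^+ 2).
  by rewrite expr2; apply: opboundM; [lra|exact: (hX _ hA)|exact: (hX _ hS)].
have hdiff : opbound (P - X * Y) (c ^+ 2 * C ^+ 2).
  rewrite PXY; apply: opboundN; have := opboundZ (c ^+ 2) (opboundM C0 hA hS).
  by rewrite ger0_norm ?sqr_ge0// -expr2.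
have hn := opbound_subX n r1 (mulr_ge0 (sqr_ge0 _) (sqr_ge0 _)) hP hXY hdiff.
have rn : (1 + c * C) ^+ 2 ^+ n <= expR (2 * C).
  rewrite -exprM mulnC exprM.
  have -> : expR (2 * C) = expR C ^+ 2 by rewrite -expRM_natl.
  rewrite lerXn2r ?nnegrE ?exprn_ge0 ?expR_ge0//; first by lra.
  have -> : expR C = expR (c * C) ^+ n.
    by rewrite -expRM_natl mulrA divff ?mul1r// gt_eqF.
  by rewrite lerXn2r ?nnegrE ?expR_ge0//; [lra|exact: expR_ge1Dx].
have trX : \tr ((X * Y) ^+ n) <= \tr (X ^+ n * Y ^+ n).
  by rewrite nE; apply: (mxtrace_pow2_ineqs k).2; rewrite linearD linearZ /= trmx1 ?symA ?symS.
have := le_trans (ler_norm _) (opbound_trace hn).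
rewrite linearB /= lerBlDr => /le_trans; apply.
rewrite addrC lerD//; rewrite -[leRHS]mulrA ler_wpM2l//.
have -> : n%:R * (1 + c * C) ^+ 2 ^+ n * (c ^+ 2 * C ^+ 2) =
    c * (C ^+ 2 * (1 + c * C) ^+ 2 ^+ n).
  have nc : n%:R * c = 1 by rewrite divff// gt_eqF.
  transitivity (n%:R * c * (c * (C ^+ 2 * (1 + c * C) ^+ 2 ^+ n))); first by ring.
  by rewrite nc mul1r.
by rewrite mulrC ler_wpM2r// ler_wpM2l// sqr_ge0.
Qed.

End euler_power.

(** * The operator norm *)

Section operator_norm.
Context {R : realType} {d : nat}.
Implicit Types (A Z : 'M[R]_d) (u : 'cV[R]_d) (c C : R).

Lemma opbound_unit A c :
  (forall u, enorm u = 1 -> enorm (A *m u) <= c) -> opbound A c.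
Proof.
move=> h u; have [u0|u0] := eqVneq (enorm u) 0.
  by move/eqP : (u0); rewrite enorm_eq0 => /eqP ->; rewrite mulmx0 enorm0 mulr0.
have u_gt0 : 0 < enorm u by rewrite lt_def u0 enorm_ge0.
have := h ((enorm u)^-1 *: u).
rewrite enormZ -scalemxAr enormZ ger0_norm ?invr_ge0 ?enorm_ge0//.
by rewrite mulVf// => /(_ erefl); rewrite mulrC ler_pdivrMr.
Qed.

Lemma has_sup_opnorm A :
  has_sup [set enorm (A *m v) | v in [set v : 'cV[R]_d | enorm v <= 1]].
Proof.
split; first by exists (enorm (A *m 0)), 0 => //=; rewrite enorm0.
exists (Num.sqrt (\tr (A * A^T))) => _ /= [v v1 <-].
rewrite -(@ger0_norm _ (enorm _)) ?enorm_ge0// -sqrtr_sqr ler_wsqrtr//.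
apply: le_trans (enorm_mul_le_frobenius A v) _.
have tr0 : 0 <= \tr (A * A^T).
  by rewrite mxtrace_sqr_tr; do 2 (apply: sumr_ge0 => ? _); exact: sqr_ge0.
by rewrite ler_piMr// -enorm_sqr expr_le1 ?enorm_ge0.
Qed.

Lemma opbound_opnorm A : opbound A (opnorm A).
Proof.
apply: opbound_unit => u u1; apply: ub_le_sup; first exact: (has_sup_opnorm A).2.
by exists u => //=; rewrite u1.
Qed.

Lemma opnorm_le A c : opbound A c -> 0 <= c -> opnorm A <= c.
Proof.
move=> hA c0; apply: ge_sup; first exact: (has_sup_opnorm A).1.
move=> _ /= [v v1 <-]; apply: le_trans (hA v) _.
by rewrite ler_piMr.
Qed.

Lemma opnorm_ge0 A : 0 <= opnorm A.
Proof.
apply: le_trans (enorm_ge0 (A *m 0)) _.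
apply: ub_le_sup; first exact: (has_sup_opnorm A).2.
by exists 0 => //=; rewrite enorm0.
Qed.

Lemma opnorm_gt0 A : A != 0 -> 0 < opnorm A.
Proof.
move=> A0; rewrite lt_def opnorm_ge0 andbT; apply: contra A0 => /eqP n0.
apply/eqP/matrixP => i j; rewrite mxE; apply/eqP; rewrite -normr_le0 -n0.
exact: opbound_entry (@opbound_opnorm A).
Qed.

(** Even power traces determine the norm of a symmetric matrix, because
    |Z u|^(2j) <= tr Z^(2j) <= d ||Z||^(2j); this exhibits the norm as a
    measurable function of the entries. *)
Lemma opnorm_sym_leP Z c : Z^T = Z -> 0 <= c ->
  (opnorm Z <= c) <-> (forall j, \tr (Z ^+ j.*2) <= d%:R * c ^+ j.*2).
Proof.
move=> symZ c0; split=> [Zc j|htr].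
  apply: le_trans (ler_norm _) _; apply: opbound_trace; apply: opboundX => //.
  exact: opbound_le Zc (@opbound_opnorm Z).
apply: opnorm_le => //; apply: opbound_unit => u u1.
have hs j : enorm (Z *m u) ^+ j.*2 <= d%:R * c ^+ j.*2.
  exact: le_trans (mxtrace_sym_even_ge _ symZ u1) (htr j).
move: (enorm _) (enorm_ge0 (Z *m u)) hs => s s0 hs.
rewrite leNgt; apply/negP => cs.
have [c00|c_neq0] := eqVneq c 0.
  have := hs 1%N; rewrite c00 expr0n /= mulr0 => h.
  have : 0 < s ^+ 2 by rewrite exprn_gt0// -c00.
  by rewrite ltNge h.
have c_gt0 : 0 < c by rewrite lt_def c_neq0.
(* by Bernoulli, (s / c)^m is unbounded *)
have h m : m.*2%:R * (s / c - 1) < d%:R + 1.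
  have bern k : 1 + k%:R * (s / c - 1) <= (s / c) ^+ k.
    elim: k => [|k IH]; first by rewrite mul0r addr0 expr0.
    have x0 : 0 <= s / c - 1 by rewrite subr_ge0 ler_pdivlMr ?mul1r// ltW.
    rewrite exprS -natr1; have k0 : 0 <= k%:R :> R by [].
    apply: le_trans (ler_wpM2l _ IH); last by rewrite divr_ge0.
    have := mulr_ge0 k0 (mulr_ge0 x0 x0); nra.
  have := bern m.*2; have := hs m.
  rewrite -ler_pdivrMr ?exprn_gt0// -expr_div_n; lra.
have x0 : 0 < s / c - 1 by rewrite subr_gt0 ltr_pdivlMr ?mul1r.
have := h (Num.truncn ((d%:R + 1) / (s / c - 1))).+1.
rewrite -ltr_pdivlMr// => /ltW; apply/negP; rewrite -ltNge.
apply: lt_le_trans (truncnS_gt _) _.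
by rewrite ler_nat -addnn leq_addr.
Qed.

Lemma expR_le_euler (s : R) n : (0 < n)%N -> 0 <= s ->
  expR (s - s ^+ 2 / n%:R) <= (1 + s / n%:R) ^+ n.
Proof.
move=> n0 s0; have n_gt0 : 0 < n%:R :> R by rewrite ltr0n.
have := divr_ge0 s0 (ltW n_gt0).
have -> : s - s ^+ 2 / n%:R = n%:R * (s / n%:R - (s / n%:R) ^+ 2).
  by field; rewrite gt_eqF.
move: (s / n%:R) => y y0; have y1 : 0 < 1 + y by lra.
rewrite expRM_natl lerXn2r ?nnegrE ?expR_ge0//; first by lra.
apply: (@le_trans _ _ (expR (y / (1 + y)))).
  rewrite ler_expR ler_pdivlMr//; have := mulr_ge0 (mulr_ge0 y0 y0) y0; nra.
rewrite -[leRHS]invrK -[leLHS]invrK lef_pV2 ?posrE ?invr_gt0 ?expR_gt0//.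
rewrite -expRN; apply: le_trans (expR_ge1Dx _).
rewrite le_eqVlt; apply/orP; left; apply/eqP; field.
by rewrite gt_eqF.
Qed.

(** On [0, C] the functions e^s and (1 + s / n)^n differ by a factor of at most
    e^(C^2 / n); the supremum over unit vectors passes through the increasing
    exponential. *)
Lemma expR_opnorm_le n Z C : (0 < d)%N -> (0 < n)%N -> ~~ odd n -> Z^T = Z ->
  opbound Z C ->
  expR (opnorm Z) <=
  expR (C ^+ 2 / n%:R) * (\tr (euler_mx n Z) + \tr (euler_mx n (- Z))).
Proof.
move=> d0 n0 n_even symZ hZ; set b := \tr _ + _.
have n_gt0 : 0 < n%:R :> R by rewrite ltr0n.
have main u : enorm u = 1 -> expR (enorm (Z *m u)) <= expR (C ^+ 2 / n%:R) * b.
  move=> u1; have s0 := enorm_ge0 (Z *m u).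
  have sC : enorm (Z *m u) <= C by have := hZ u; rewrite u1 mulr1.
  have := le_trans (expR_le_euler n0 s0) (euler_mx_trace_ge n_even symZ u1).
  rewrite -/b expRD expRN ler_pdivrMr ?expR_gt0// mulrC => /le_trans; apply.
  have b0 : 0 <= b.
    apply: le_trans (euler_mx_trace_ge n_even symZ u1).
    by rewrite exprn_ge0// addr_ge0// divr_ge0// ltW.
  rewrite ler_wpM2r// ler_expR ler_pM2r ?invr_gt0//.
  by rewrite lerXn2r ?nnegrE// (le_trans s0).
have i : 'I_d by case: d d0 => // d' _; exact: ord0.
have b1 u : enorm u = 1 -> 1 <= expR (C ^+ 2 / n%:R) * b.
  by move=> /main; apply: le_trans; rewrite -expR0 ler_expR enorm_ge0.
have {}b1 := b1 _ (enorm_delta i).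
have b_gt0 : 0 < expR (C ^+ 2 / n%:R) * b by lra.
rewrite -[leRHS]lnK ?posrE// ler_expR; apply: opnorm_le; last exact: ln_ge0.
apply: opbound_unit => u /main h.
by rewrite -ler_expR lnK.
Qed.

End operator_norm.

(** * Matrices with entries in an algebra of functions *)

Section function_algebra.
Context {R : realType} {U : Type}.

(** The closure properties of matrix polynomials are needed for three classes
    of functions: measurable, bounded measurable, and depending on the first
    samples only. *)
Definition function_algebra (F : (U -> R) -> Prop) :=
  [/\ forall c, F (fun _ => c),
      forall f g, F f -> F g -> F (fun x => f x + g x) &
      forall f g, F f -> F g -> F (fun x => f x * g x)].

Context {F : (U -> R) -> Prop} (algF : function_algebra F) {d : nat}.
Implicit Types (A B : U -> 'M[R]_d).

Definition entries_in A := forall i j, F (fun x => A x i j).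

Let F_cst c : F (fun _ => c). Proof. by case: algF. Qed.

Let FD f g : F f -> F g -> F (fun x => f x + g x).
Proof. by case: algF => _ + _; exact. Qed.

Let FM f g : F f -> F g -> F (fun x => f x * g x).
Proof. by case: algF => _ _; exact. Qed.

Lemma function_algebra_sum I (r : seq I) (p : pred I) (f : I -> U -> R) :
  (forall i, p i -> F (f i)) -> F (fun x => \sum_(i <- r | p i) f i x).
Proof.
move=> h; elim: r => [|i r IH]; first by under eq_fun do rewrite big_nil.
under eq_fun do rewrite big_cons; case: (boolP (p i)) => // pi.
exact: FD (h _ pi) IH.
Qed.

Lemma entries_in_cst (A : 'M[R]_d) : entries_in (fun _ => A).
Proof. by move=> i j. Qed.

Lemma entries_inD A B : entries_in A -> entries_in B -> entries_in (fun x => A x + B x).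
Proof. by move=> hA hB i j; under eq_fun do rewrite mxE; exact: FD. Qed.

Lemma entries_inZ c A : entries_in A -> entries_in (fun x => c *: A x).
Proof. by move=> hA i j; under eq_fun do rewrite mxE; exact: FM. Qed.

Lemma entries_inN A : entries_in A -> entries_in (fun x => - A x).
Proof.
by move=> hA; under eq_fun do rewrite -scaleN1r; exact: entries_inZ.
Qed.

Lemma entries_inB A B : entries_in A -> entries_in B -> entries_in (fun x => A x - B x).
Proof. by move=> hA hB; apply: entries_inD => //; exact: entries_inN. Qed.

Lemma entries_inM A B : entries_in A -> entries_in B -> entries_in (fun x => A x * B x).
Proof.
move=> hA hB i j; under eq_fun do rewrite -mulmxE mxE.
by apply: function_algebra_sum => l _; exact: FM.
Qed.

Lemma entries_inX A n : entries_in A -> entries_in (fun x => A x ^+ n).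
Proof.
move=> hA; elim: n => [|n IH]; first exact: entries_in_cst.
by under eq_fun do rewrite exprS; exact: entries_inM.
Qed.

Lemma entries_in_euler A n : entries_in A -> entries_in (fun x => euler_mx n (A x)).
Proof.
move=> hA; apply: entries_inX; apply: entries_inD; first exact: entries_in_cst.
exact: entries_inZ.
Qed.

Lemma entries_in_sum I (r : seq I) (p : pred I) (A : I -> U -> 'M[R]_d) :
  (forall i, p i -> entries_in (A i)) ->
  entries_in (fun x => \sum_(i <- r | p i) A i x).
Proof.
move=> h a b; under eq_fun do rewrite summxE.
by apply: function_algebra_sum => i pi; exact: h.
Qed.

Lemma entries_in_trace A : entries_in A -> F (fun x => \tr (A x)).
Proof. by move=> hA; apply: function_algebra_sum => i _; exact: hA. Qed.

Lemma entries_in_quad A u v : entries_in A -> F (fun x => dotv u (A x *m v)).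
Proof.
move=> hA; apply: function_algebra_sum => i _; apply: FM => //.
under eq_fun do rewrite mxE.
by apply: function_algebra_sum => j _; exact: FM.
Qed.

End function_algebra.

Arguments entries_in {R U} F {d} A.

(** * Bounded measurable functions *)

Section bounded_measurable.
Context {R : realType} {disp : measure_display} {T : measurableType disp}.
Implicit Types (phi psi : T -> R).

Definition bounded_measurable phi :=
  measurable_fun setT phi /\ exists M, forall x, `|phi x| <= M.

Lemma bounded_measurable_cst (c : R) : bounded_measurable (fun _ => c).
Proof. by split; [exact: measurable_cst | exists `|c|]. Qed.

Lemma bounded_measurable_indic (A : set T) :
  measurable A -> bounded_measurable (\1_A : T -> R).
Proof.
move=> mA; split; first exact: measurable_indic.
by exists 1 => x; rewrite indicE; case: (x \in A); rewrite ?normr1 ?normr0.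
Qed.

Lemma bounded_measurableD phi psi : bounded_measurable phi ->
  bounded_measurable psi -> bounded_measurable (fun x => phi x + psi x).
Proof.
move=> [mphi [M hM]] [mpsi [M' hM']]; split; first exact: measurable_funD.
exists (M + M') => x; apply: le_trans (ler_normD _ _) _; exact: lerD.
Qed.

Lemma bounded_measurableM phi psi : bounded_measurable phi ->
  bounded_measurable psi -> bounded_measurable (fun x => phi x * psi x).
Proof.
move=> [mphi [M hM]] [mpsi [M' hM']]; split; first exact: measurable_funM.
by exists (M * M') => x; rewrite normrM ler_pM.
Qed.

Lemma function_algebra_bounded : function_algebra bounded_measurable.
Proof.
by split; [exact: bounded_measurable_cst | exact: bounded_measurableD |
  exact: bounded_measurableM].
Qed.

Lemma bounded_measurableZ (c : R) phi : bounded_measurable phi ->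
  bounded_measurable (fun x => c * phi x).
Proof. by move=> ?; apply: bounded_measurableM => //; exact: bounded_measurable_cst. Qed.

Lemma bounded_measurableN phi : bounded_measurable phi ->
  bounded_measurable (fun x => - phi x).
Proof.
move=> /(bounded_measurableZ (-1)); congr bounded_measurable.
by apply/funext => x; rewrite mulN1r.
Qed.

Lemma bounded_measurableB phi psi : bounded_measurable phi ->
  bounded_measurable psi -> bounded_measurable (fun x => phi x - psi x).
Proof. by move=> ? /bounded_measurableN; exact: bounded_measurableD. Qed.

Lemma bounded_measurable_sum I (r : seq I) (p : pred I) (F : I -> T -> R) :
  (forall i, p i -> bounded_measurable (F i)) ->
  bounded_measurable (fun x => \sum_(i <- r | p i) F i x).
Proof. exact: (function_algebra_sum function_algebra_bounded). Qed.

Lemma bounded_measurable_prod I (r : seq I) (p : pred I) (F : I -> T -> R) :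
  (forall i, p i -> bounded_measurable (F i)) ->
  bounded_measurable (fun x => \prod_(i <- r | p i) F i x).
Proof.
move=> h; elim: r => [|i r IH].
  by under eq_fun do rewrite big_nil; exact: bounded_measurable_cst.
under eq_fun do rewrite big_cons; case: (boolP (p i)) => // pi.
exact: bounded_measurableM (h _ pi) IH.
Qed.

(** A linear functional that is continuous for the uniform norm is determined
    by its values on indicators: a function with values in [0, K] is within
    K / n of a multiple of the sum of the indicators of n of its level sets. *)
Lemma functional_indic_eq0 (F : (T -> R) -> R) (C : R) :
  (forall phi psi, bounded_measurable phi -> bounded_measurable psi ->
     F (fun x => phi x + psi x) = F phi + F psi) ->
  (forall c phi, bounded_measurable phi -> F (fun x => c * phi x) = c * F phi) ->
  (forall phi M, bounded_measurable phi -> (forall x, `|phi x| <= M) ->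
     `|F phi| <= C * M) ->
  (forall A, measurable A -> F \1_A = 0) ->
  forall phi, bounded_measurable phi -> F phi = 0.
Proof.
move=> FD FZ Fle F1.
have Fcst c : F (fun _ => c) = 0.
  have := FZ c _ (bounded_measurable_indic measurableT).
  rewrite F1// mulr0; under eq_fun do rewrite indicT mulr1.
  by [].
have Fsum n (f : nat -> T -> R) : (forall i, bounded_measurable (f i)) ->
    (forall i, F (f i) = 0) -> F (fun x => \sum_(i < n) f i x) = 0.
  move=> bf f0; elim: n => [|n IH].
    by under eq_fun do rewrite big_ord0; exact: Fcst.
  under eq_fun do rewrite big_ord_recr /=.
  by rewrite FD// ?IH ?f0 ?addr0//; exact: bounded_measurable_sum.
have Fpos phi K : bounded_measurable phi -> 0 < K ->
    (forall x, 0 <= phi x < K) -> F phi = 0.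
  move=> bphi K0 phiK; have [mphi _] := bphi.
  have approx n : `|F phi| <= C * (K / n.+1%:R).
    have n0 : 0 < n.+1%:R :> R by [].
    pose lev i := [set x | i.+1%:R <= n.+1%:R * (phi x / K)].
    have mlev i : measurable (lev i).
      have mf : measurable_fun setT (fun x => n.+1%:R * (phi x / K)).
        by apply: measurable_funM => //; exact: measurable_funM.
      have := measurable_fun_ler (measurable_cst (i.+1%:R : R)) mf.
      by move=> /(_ measurableT [set true] I); rewrite setTI.
    pose phin x := \sum_(i < n.+1) (K / n.+1%:R) * \1_(lev i) x.
    have bphin : bounded_measurable phin.
      apply: bounded_measurable_sum => i _; apply: bounded_measurableZ.
      exact: bounded_measurable_indic.
    have phinE x : phin x = (K / n.+1%:R) * (Num.truncn (n.+1%:R * (phi x / K)))%:R.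
      rewrite /phin -mulr_sumr; congr (_ * _).
      under eq_bigr do rewrite indicE.
      set y := n.+1%:R * _.
      have yn : (Num.truncn y <= n.+1)%N.
        rewrite truncn_le_nat -natr1; apply: (@le_lt_trans _ _ n.+1%:R); last lra.
        rewrite /y ger_pMr// ler_pdivrMr// mul1r ltW//.
        by case/andP: (phiK x).
      rewrite -natr_sum; congr _%:R.
      transitivity (\sum_(i < n.+1 | (i < Num.truncn y)%N) 1)%N.
        rewrite [RHS]big_mkcond /=; apply: eq_bigr => i _.
        rewrite truncn_gt_nat; case: ifPn => h.
          by rewrite mem_set.
        by rewrite memNset// /lev /= => h'; rewrite h' in h.
      by rewrite -(big_ord_widen _ (fun _ => 1%N) yn) sum1_card card_ord.
    have := Fle (fun x => phi x - phin x) (K / n.+1%:R).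
    have -> : F (fun x => phi x - phin x) = F phi.
      have := FD phi (fun x => - phin x) bphi (bounded_measurableN bphin).
      move=> ->; have := FZ (-1) _ bphin.
      under eq_fun do rewrite mulN1r; move=> ->.
      have -> : F phin = 0; last by rewrite mulr0 addr0.
      apply: (Fsum n.+1 (fun i x => K / n.+1%:R * \1_(lev i) x)) => i.
        by apply: bounded_measurableZ; exact: bounded_measurable_indic.
      by rewrite FZ ?F1 ?mulr0//; exact: bounded_measurable_indic.
    apply; first exact: bounded_measurableB.
    move=> x; rewrite phinE; have /andP[p0 pK] := phiK x.
    have y0 : 0 <= n.+1%:R * (phi x / K).
      by rewrite mulr_ge0// divr_ge0// ltW.
    have /andP[t1 t2] := truncn_itv y0.
    have phiE : phi x = K / n.+1%:R * (n.+1%:R * (phi x / K)).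
      move: n.+1%:R n0 => N N0; field.
      by rewrite !gt_eqF.
    rewrite [X in X - _]phiE -mulrBr.
    have Kn : 0 <= K / n.+1%:R by rewrite divr_ge0// ltW.
    rewrite normrM (ger0_norm Kn) ler_piMr//.
    move: (n.+1%:R * (phi x / K)) t1 t2 => y; rewrite -natr1 => t1 t2.
    by rewrite ger0_norm; lra.
  apply/eqP; rewrite -normr_le0 leNgt; apply/negP => F0.
  have := approx (Num.truncn (C * K / `|F phi|)).
  rewrite mulrA ler_pdivlMr// mulrC -ler_pdivlMr//.
  by rewrite leNgt truncnS_gt.
move=> phi bphi; have [_ [M hM]] := bphi.
have M0 : 0 <= `|M| by [].
have bM : bounded_measurable (fun x => phi x + `|M|).
  by apply: bounded_measurableD => //; exact: bounded_measurable_cst.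
have := Fpos _ (2 * `|M| + 1) bM; rewrite FD//; last exact: bounded_measurable_cst.
rewrite Fcst addr0; apply; first by lra.
move=> x; have := le_trans (hM x) (ler_norm M); rewrite ler_norml; lra.
Qed.

End bounded_measurable.

Lemma bounded_measurable_comp {R : realType} {disp disp' : measure_display}
    {T : measurableType disp} {T' : measurableType disp'}
    (Y : T' -> T) (phi : T -> R) : measurable_fun setT Y ->
  bounded_measurable phi -> bounded_measurable (fun w => phi (Y w)).
Proof.
move=> mY [mphi [M hM]]; split; first exact: measurableT_comp.
by exists M.
Qed.

(** * Expectation and independence *)

Section real_expectation.
Context {R : realType} {disp : measure_display} {Omega : measurableType disp}
  (P : probability Omega R).
Implicit Types (V W : Omega -> R).

(** The expectation as a real number: all the variables of the moment method
    are bounded, hence integrable, and infinite values do not occur. *)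
Definition Ex W : R := \int[P]_w W w.

Lemma bounded_integrable W :
  bounded_measurable W -> P.-integrable setT (EFin \o W).
Proof.
move=> [mW [M hM]]; apply: measurable_bounded_integrable => //.
  exact: fin_num_fun_lty.
exists M; split; first exact: num_real.
by move=> x Mx w _; apply: le_trans (hM w) (ltW Mx).
Qed.

Lemma Ex_EFin W : bounded_measurable W -> (\int[P]_w (W w)%:E = (Ex W)%:E)%E.
Proof. by move=> bW; rewrite fineK//; exact/integrable_fin_num/bounded_integrable. Qed.

Lemma Ex_cst c : Ex (fun _ => c) = c.
Proof.
rewrite /Ex Rintegral_cst//; have := probability_setT P => /= ->.
by rewrite mulr1.
Qed.

Lemma ExD V W : bounded_measurable V -> bounded_measurable W ->
  Ex (fun w => V w + W w) = Ex V + Ex W.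
Proof. by move=> bV bW; apply: RintegralD => //; exact: bounded_integrable. Qed.

Lemma ExZ c W : bounded_measurable W -> Ex (fun w => c * W w) = c * Ex W.
Proof. by move=> bW; apply: RintegralZl => //; exact: bounded_integrable. Qed.

Lemma ExN W : bounded_measurable W -> Ex (fun w => - W w) = - Ex W.
Proof. by move=> bW; rewrite -mulN1r -ExZ//; under eq_fun do rewrite -mulN1r. Qed.

Lemma ExB V W : bounded_measurable V -> bounded_measurable W ->
  Ex (fun w => V w - W w) = Ex V - Ex W.
Proof. by move=> bV bW; rewrite ExD ?ExN//; exact: bounded_measurableN. Qed.

Lemma Ex_sum I (r : seq I) (F : I -> Omega -> R) :
  (forall i, bounded_measurable (F i)) ->
  Ex (fun w => \sum_(i <- r) F i w) = \sum_(i <- r) Ex (F i).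
Proof.
move=> h; elim: r => [|i r IH].
  by under eq_fun do rewrite big_nil; rewrite Ex_cst big_nil.
under eq_fun do rewrite big_cons; rewrite ExD// ?big_cons ?IH//.
exact: bounded_measurable_sum.
Qed.

Lemma le_Ex V W : bounded_measurable V -> bounded_measurable W ->
  (forall w, V w <= W w) -> Ex V <= Ex W.
Proof. by move=> bV bW h; apply: le_Rintegral => //; exact: bounded_integrable. Qed.

Lemma normr_Ex_le W M : bounded_measurable W -> (forall w, `|W w| <= M) ->
  `|Ex W| <= M.
Proof.
move=> bW h; rewrite ler_norml.
have hw w : - M <= W w <= M by rewrite -ler_norml.
apply/andP; split.
- rewrite -[leLHS]Ex_cst; apply: le_Ex => // [|w]; last by case/andP: (hw w).
  exact: bounded_measurable_cst.
- rewrite -[leRHS]Ex_cst; apply: le_Ex => // [|w]; last by case/andP: (hw w).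
  exact: bounded_measurable_cst.
Qed.

Lemma Ex_indic (A : set Omega) : measurable A -> Ex \1_A = fine (P A).
Proof. by move=> mA; rewrite /Ex /Rintegral integral_indic// setIT. Qed.

Lemma eq_law_Ex disp' (T : measurableType disp') (X Y : Omega -> T) (phi : T -> R) :
  measurable_fun setT X -> measurable_fun setT Y ->
  (forall A, measurable A -> P (X @^-1` A) = P (Y @^-1` A)) ->
  bounded_measurable phi -> Ex (fun w => phi (X w)) = Ex (fun w => phi (Y w)).
Proof.
move=> mX mY XY bphi; apply/eqP; rewrite -subr_eq0; apply/eqP.
apply: (@functional_indic_eq0 _ _ _
  (fun phi => Ex (fun w => phi (X w)) - Ex (fun w => phi (Y w))) 2) => //.
- move=> f g bf bg; rewrite !ExD; last 4 first.
  + exact: bounded_measurable_comp.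
  + exact: bounded_measurable_comp.
  + exact: bounded_measurable_comp.
  + exact: bounded_measurable_comp.
  by ring.
- by move=> c f bf; rewrite !ExZ; [ring|exact: bounded_measurable_comp..].
- move=> f M bf hM; apply: le_trans (ler_normB _ _) _.
  by rewrite mulr_natl mulr2n lerD//; apply: normr_Ex_le => //;
    exact: bounded_measurable_comp.
- move=> A mA.
  have h (Z : Omega -> T) : measurable_fun setT Z ->
      Ex (fun w => \1_A (Z w)) = fine (P (Z @^-1` A)).
    move=> mZ; rewrite -Ex_indic//.
    by rewrite -[_ @^-1` _]setTI; exact: mZ.
  by rewrite !h// XY// subrr.
Qed.

End real_expectation.

Section independence.
Context {R : realType} {disp : measure_display} {Omega : measurableType disp}
  (P : probability Omega R) {disp' : measure_display}
  {T : measurableType disp'} {N : nat} (Y : 'I_N -> {RV P >-> T}).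
Hypothesis indepY : mutually_independent Y.
Implicit Types (phi : 'I_N -> T -> R) (V W : Omega -> R).
Local Notation Ex := (Ex P).

Let mY i : measurable_fun setT (Y i). Proof. exact: measurable_funPT. Qed.

Let bmY i (psi : T -> R) : bounded_measurable psi ->
  bounded_measurable (fun w => psi (Y i w)).
Proof. exact: bounded_measurable_comp. Qed.

Lemma indep_Ex_prod_indic (A : 'I_N -> set T) : (forall i, measurable (A i)) ->
  Ex (fun w => \prod_i \1_(A i) (Y i w)) = \prod_i Ex (fun w => \1_(A i) (Y i w)).
Proof.
move=> mA.
have mYA i : measurable (Y i @^-1` A i) by rewrite -[_ @^-1` _]setTI; exact: mY.
have -> : (fun w => \prod_i \1_(A i) (Y i w)) =
    \1_(\bigcap_(i in [set: 'I_N]) (Y i @^-1` A i)) :> (Omega -> R).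
  apply/funext => w; rewrite indicE; case: (boolP (w \in _)) => h.
    rewrite big1// => i _; rewrite indicE mem_set//.
    by move: h; rewrite inE => /(_ i); apply.
  suff [i hi] : exists i, ~ A i (Y i w).
    by rewrite (bigD1 i)//= indicE memNset ?mul0r.
  apply: contrapT => /forallNP h'; move/negP : h; apply; rewrite inE => i _.
  exact: contrapT (h' i).
rewrite Ex_indic; last first.
  by apply: fin_bigcap_measurable => //; exact: finite_finset.
rewrite indepY//.
have -> : (\prod_(i < N) P (Y i @^-1` A i) =
    (\prod_i Ex (fun w => \1_(A i) (Y i w)))%:E)%E; last by [].
rewrite -prodEFin; apply: eq_bigr => i _.
rewrite -[fun w => _]/(\1_(Y i @^-1` A i) : Omega -> R) Ex_indic// fineK//.
exact: fin_num_measure.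
Qed.

Let upd phi (j : 'I_N) psi i := if i == j then psi else phi i.

(** Both sides are continuous linear functionals of each factor, so that bounded
    functions can replace indicators one index at a time. *)
Lemma indep_Ex_prod phi : (forall i, bounded_measurable (phi i)) ->
  Ex (fun w => \prod_i phi i (Y i w)) = \prod_i Ex (fun w => phi i (Y i w)).
Proof.
suff H k : forall phi, (forall i, bounded_measurable (phi i)) ->
    (forall i : 'I_N, (k <= i)%N -> exists2 A, measurable A & phi i = \1_A) ->
    Ex (fun w => \prod_i phi i (Y i w)) = \prod_i Ex (fun w => phi i (Y i w)).
  by move=> bphi; apply: (H N) => // i; rewrite leqNgt ltn_ord.
elim: k => [|k IH] {}phi bphi hphi.
  pose A i := s2val (cid2 (hphi i (leq0n i))).
  have mA i : measurable (A i) by exact: (s2valP (cid2 (hphi i (leq0n i)))).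
  have phiE : phi = fun i => \1_(A i).
    by apply/funext => i; exact: (s2valP' (cid2 (hphi i (leq0n i)))).
  by rewrite phiE; exact: indep_Ex_prod_indic.
have [Nk|kN] := leqP N k.
  by apply: IH => // i; rewrite leqNgt (leq_trans (ltn_ord i)).
pose j := Ordinal kN.
pose W w := \prod_(i | i != j) phi i (Y i w).
pose c := \prod_(i | i != j) Ex (fun w => phi i (Y i w)).
have bW : bounded_measurable W.
  by apply: bounded_measurable_prod => i _; exact: bmY.
have bMW (psi : T -> R) : bounded_measurable psi ->
    bounded_measurable (fun w => psi (Y j w) * W w).
  by move=> ?; apply: bounded_measurableM => //; exact: bmY.
have [_ [B hB]] := bW.
rewrite [RHS](bigD1 j)//= -/c.
under eq_fun do rewrite (bigD1 j)//= -/(W _).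
apply/eqP; rewrite -subr_eq0; apply/eqP.
apply: (@functional_indic_eq0 _ _ _
  (fun psi => Ex (fun w => psi (Y j w) * W w) - Ex (fun w => psi (Y j w)) * c)
  (`|B| + `|c|)) => //.
- move=> f g bf bg; under eq_fun do rewrite mulrDl.
  by rewrite !ExD; [ring|..]; (exact: bmY || exact: bMW).
- move=> a f bf; under eq_fun do rewrite -mulrA.
  by rewrite !ExZ; [ring|..]; (exact: bmY || exact: bMW).
- move=> f M bf hM; apply: le_trans (ler_normB _ _) _.
  rewrite mulrDl lerD//; last first.
    by rewrite normrM mulrC ler_wpM2l//; apply: normr_Ex_le => //; exact: bmY.
  apply: normr_Ex_le => [|w]; first exact: bMW.
  by rewrite normrM mulrC ler_pM// (le_trans (hB w))// ler_norm.
- move=> A mA; apply/eqP; rewrite subr_eq0; apply/eqP.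
  have E : Ex (fun w => \prod_i upd phi j \1_A i (Y i w)) =
      \prod_i Ex (fun w => upd phi j \1_A i (Y i w)).
    apply: IH => [i|i ki]; rewrite /upd.
      by case: ifP => // _; exact: bounded_measurable_indic.
    case: ifP => [_|ij]; first by exists A.
    apply: hphi; rewrite ltn_neqAle ki andbT; apply: contraFN ij => /eqP ki'.
    by apply/eqP/val_inj.
  have updj : upd phi j \1_A j = \1_A by rewrite /upd eqxx.
  have updN i : i != j -> upd phi j \1_A i = phi i.
    by move=> ij; rewrite /upd (negPf ij).
  transitivity (Ex (fun w => \prod_i upd phi j \1_A i (Y i w))).
    congr Ex; apply/funext => w; rewrite (bigD1 j)//= updj; congr (_ * _).
    by apply: eq_bigr => i /updN ->.
  rewrite E (bigD1 j)//= updj; congr (_ * _).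
  by apply: eq_bigr => i /updN ->.
Qed.

End independence.

(** * Functions of the first samples *)

Section past.
Context {R : realType} {disp : measure_display} {Omega : measurableType disp}
  (P : probability Omega R) {disp' : measure_display}
  {T : measurableType disp'} {N : nat} (Y : 'I_N -> {RV P >-> T}).
Implicit Types (phi : 'I_N -> T -> R) (V W : Omega -> R).

(** The algebra generated by the bounded functions of one of the first k
    samples. It contains the entries of all matrix polynomials in these
    samples, and its elements are sums of products, for which independence
    from sample k (counting from 0) is the product rule, so that the
    sigma-algebra generated by the first samples is not needed. *)
Inductive past (k : nat) : (Omega -> R) -> Prop :=
| past_prod c phi : (forall i, bounded_measurable (phi i)) ->
    (forall i : 'I_N, (k <= i)%N -> phi i = fun _ => 1) ->
    past k (fun w => c * \prod_i phi i (Y i w))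
| past_add V W : past k V -> past k W -> past k (fun w => V w + W w).

Lemma past_ext k V W : (forall w, V w = W w) -> past k V -> past k W.
Proof. by move=> /funext ->. Qed.

Lemma past_cst k c : past k (fun _ => c).
Proof.
apply: past_ext (past_prod c (phi := fun _ _ => 1) _ _) => // [w|i].
  by rewrite big1 ?mulr1.
exact: bounded_measurable_cst.
Qed.

Lemma past_single k (j : 'I_N) psi : (j < k)%N -> bounded_measurable psi ->
  past k (fun w => psi (Y j w)).
Proof.
move=> jk bpsi.
apply: past_ext (past_prod 1
  (phi := fun i => if i == j then psi else fun _ => 1) _ _) => [w|i|i ki].
- by rewrite mul1r (bigD1 j)//= eqxx big1 ?mulr1// => i /negPf ->.
- by case: ifP => // _; exact: bounded_measurable_cst.
- by case: eqP => // ij; move: ki; rewrite ij leqNgt jk.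
Qed.

Lemma pastM k V W : past k V -> past k W -> past k (fun w => V w * W w).
Proof.
move=> pV; elim: pV W => [c phi bphi phi1|V1 V2 _ IH1 _ IH2] W pW; last first.
  by apply: past_ext (past_add (IH1 _ pW) (IH2 _ pW)) => w; rewrite mulrDl.
elim: pW => [c' psi bpsi psi1|W1 W2 _ IH1 _ IH2]; last first.
  by apply: past_ext (past_add IH1 IH2) => w; rewrite mulrDr.
apply: past_ext (past_prod (c * c') (phi := fun i x => phi i x * psi i x) _ _).
- by move=> w; rewrite big_split /= mulrACA.
- by move=> i; exact: bounded_measurableM.
- by move=> i ki; apply/funext => x; rewrite phi1// psi1// mulr1.
Qed.

Lemma past_bounded k W : past k W -> bounded_measurable W.
Proof.
elim=> [c phi bphi _|V1 V2 _ ? _ ?]; last exact: bounded_measurableD.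
apply: bounded_measurableZ; apply: bounded_measurable_prod => i _.
by apply: bounded_measurable_comp => //; exact: measurable_funPT.
Qed.

Hypothesis indepY : mutually_independent Y.

Lemma past_indep (k : 'I_N) W (psi : T -> R) :
  past k W -> bounded_measurable psi ->
  Ex P (fun w => W w * psi (Y k w)) = Ex P W * Ex P (fun w => psi (Y k w)).
Proof.
move=> pW bpsi.
have bY i f : bounded_measurable f -> bounded_measurable (fun w => f (Y i w)).
  by apply: bounded_measurable_comp; exact: measurable_funPT.
elim: pW => [c phi bphi phi1|V1 V2 p1 IH1 p2 IH2]; last first.
  have [b1 b2] := (past_bounded p1, past_bounded p2).
  under eq_fun do rewrite mulrDl.
  rewrite !ExD ?IH1 ?IH2 ?mulrDl//; apply: bounded_measurableM => //; exact: bY.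
pose phi' i := if i == k then psi else phi i.
have bphi' i : bounded_measurable (phi' i) by rewrite /phi'; case: ifP.
have phi'k : phi' k = psi by rewrite /phi' eqxx.
have phi'N i : i != k -> phi' i = phi i by rewrite /phi' => /negPf ->.
have -> : (fun w => c * \prod_i phi i (Y i w) * psi (Y k w)) =
    (fun w => c * \prod_i phi' i (Y i w)).
  apply/funext => w; rewrite -mulrA; congr (_ * _).
  rewrite !(bigD1 k (P := predT))//= phi'k phi1// mul1r mulrC; congr (_ * _).
  by apply: eq_bigr => i /phi'N ->.
rewrite !ExZ; try by apply: bounded_measurable_prod => i _; exact: bY.
rewrite !indep_Ex_prod// !(bigD1 k (P := predT))//= phi'k phi1// Ex_cst mul1r.
rewrite -mulrA; congr (_ * _); rewrite mulrC; congr (_ * _).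
by apply: eq_bigr => i /phi'N ->.
Qed.

Lemma function_algebra_past k : function_algebra (past k).
Proof. by split; [exact: past_cst | exact: past_add | exact: pastM]. Qed.

End past.

(** * Exponential moments of sums of independent matrices *)

Section expectation_matrix.
Context {R : realType} {disp : measure_display} {Omega : measurableType disp}
  (P : probability Omega R) {d : nat}.
Implicit Types (F : Omega -> 'M[R]_d) (u v : 'cV[R]_d).

Definition Ex_mx F : 'M[R]_d := \matrix_(i, j) Ex P (fun w => F w i j).

Lemma Ex_quad F u v : entries_in bounded_measurable F ->
  Ex P (fun w => dotv u (F w *m v)) = dotv u (Ex_mx F *m v).
Proof.
move=> bF; rewrite /dotv.
have bFv i : bounded_measurable (fun w => (F w *m v) i 0).
  under eq_fun do rewrite mxE; apply: bounded_measurable_sum => j _.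
  by apply: bounded_measurableM => //; exact: bounded_measurable_cst.
rewrite Ex_sum; last by move=> i; exact: bounded_measurableZ.
apply: eq_bigr => i _; rewrite ExZ//; congr (_ * _).
under eq_fun do rewrite mxE.
rewrite Ex_sum; last first.
  by move=> j; apply: bounded_measurableM => //; exact: bounded_measurable_cst.
rewrite mxE; apply: eq_bigr => j _; rewrite mxE mulrC -ExZ//.
by under eq_fun do rewrite mulrC.
Qed.

Lemma Ex_trace_mulr F (M : 'M[R]_d) : entries_in bounded_measurable F ->
  Ex P (fun w => \tr (F w * M)) = \tr (Ex_mx F * M).
Proof.
move=> bF; rewrite mxtrace_mul_sum.
under eq_fun do rewrite mxtrace_mul_sum.
have bFM i j : bounded_measurable (fun w => F w i j * M j i).
  by apply: bounded_measurableM => //; exact: bounded_measurable_cst.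
rewrite Ex_sum; last by move=> i; exact: bounded_measurable_sum.
apply: eq_bigr => i _; rewrite Ex_sum//; apply: eq_bigr => j _.
by rewrite mxE mulrC -ExZ//; under eq_fun do rewrite mulrC.
Qed.

End expectation_matrix.

(** The case of a random W^2 against a deterministic M: each column of W sees
    only the quadratic form of M. *)
Lemma mxtrace_sqr_mul_le {R : realType} {d : nat} (W M : 'M[R]_d) (c : R) :
  W^T = W -> (forall v, dotv v (M *m v) <= c * dotv v v) ->
  \tr (W * W * M) <= c * \tr (W * W).
Proof.
move=> symW hM; rewrite mxtrace_mulrC mulrA mxtrace_mulrC.
have trE (B : 'M[R]_d) : \tr (W * (B * W)) = \sum_i dotv (col i W) (B *m col i W).
  apply: eq_bigr => i _; rewrite -!mulmxE mxE; apply: eq_bigr => j _.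
  rewrite -{1}symW !mxE; congr (_ * _).
  by apply: eq_bigr => l _; rewrite !mxE.
rewrite trE.
have -> : \tr (W * W) = \tr (W * (1 * W)) by rewrite mul1r.
rewrite trE mulr_sumr; apply: ler_sum => i _.
by rewrite mul1mx.
Qed.

(** The hypotheses of Bernstein's inequality on the summands sigma_i(Y_i); the
    number s_i bounds the quadratic form of E sigma_i(Y_i)^2. *)
Record bernstein_family {R : realType} {disp : measure_display}
    {Omega : measurableType disp} (P : probability Omega R)
    {disp' : measure_display} {T : measurableType disp'} {N d : nat}
    (Y : 'I_N -> {RV P >-> T}) (sigma : 'I_N -> T -> 'M[R]_d)
    (L : R) (s : 'I_N -> R) : Prop := BernsteinFamily {
  family_sym : forall i x, (sigma i x)^T = sigma i x ;
  family_bounded : forall i, entries_in bounded_measurable (sigma i) ;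
  family_opbound : forall i x, opbound (sigma i x) L ;
  family_centred : forall i a b, Ex P (fun w => sigma i (Y i w) a b) = 0 ;
  family_var : forall i v,
    Ex P (fun w => dotv (sigma i (Y i w) *m v) (sigma i (Y i w) *m v))
    <= s i * dotv v v }.

Section matrix_bernstein.
Context {R : realType} {disp : measure_display} {Omega : measurableType disp}
  (P : probability Omega R) {disp' : measure_display}
  {T : measurableType disp'} {N d : nat} (Y : 'I_N -> {RV P >-> T}).
Hypothesis indepY : mutually_independent Y.
Implicit Types (sigma : 'I_N -> T -> 'M[R]_d) (L t : R) (s : 'I_N -> R).
Local Notation Ex := (Ex P).

Let bY i (f : T -> R) : bounded_measurable f -> bounded_measurable (fun w => f (Y i w)).
Proof. by apply: bounded_measurable_comp; exact: measurable_funPT. Qed.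

Lemma bernstein_familyZ sigma L s t : bernstein_family Y sigma L s ->
  bernstein_family Y (fun i x => t *: sigma i x) (`|t| * L) (fun i => t ^+ 2 * s i).
Proof.
case=> sym bnd opb cen var; split.
- by move=> i x; rewrite linearZ /= sym.
- by move=> i; apply: entries_inZ => //; exact: function_algebra_bounded.
- by move=> i x; exact: opboundZ.
- move=> i a b; under eq_fun do rewrite mxE.
  by rewrite ExZ ?cen ?mulr0//; apply: (@bY i (fun x => sigma i x a b)); exact: bnd.
- move=> i v; have bq : bounded_measurable
      (fun w => dotv (sigma i (Y i w) *m v) (sigma i (Y i w) *m v)).
    apply: (@bY i (fun x => dotv (sigma i x *m v) (sigma i x *m v))).
    have := entries_in_quad function_algebra_bounded v v
      (entries_inM function_algebra_bounded (bnd i) (bnd i)).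
    congr bounded_measurable; apply/funext => x.
    by rewrite -mulmxE -mulmxA dotv_mulmx sym.
  under eq_fun do rewrite -scalemxAl dotvZl dotvZr mulrA -expr2.
  by rewrite ExZ// -mulrA ler_wpM2l ?sqr_ge0.
Qed.

Context (sigma : 'I_N -> T -> 'M[R]_d) (L : R) (s : 'I_N -> R).
Hypothesis famP : bernstein_family Y sigma L s.
Hypothesis s_ge0 : forall i, 0 <= s i.
Hypothesis L_ge0 : 0 <= L.
Hypothesis L_lt3 : L < 3.

Let g : R := (2 * (1 - L / 3))^-1.

Let g_ge0 : 0 <= g.
Proof. by move: L_lt3 => L3; rewrite invr_ge0; apply: mulr_ge0 => //; lra. Qed.

Let S i w := sigma i (Y i w).

Let bS i : entries_in bounded_measurable (S i).
Proof.
by move=> a b; apply: (@bY i (fun x => sigma i x a b)); exact: (family_bounded famP).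
Qed.

Let bSS i v : bounded_measurable (fun w => dotv (S i w *m v) (S i w *m v)).
Proof.
have := entries_in_quad function_algebra_bounded v v
  (entries_inM function_algebra_bounded (bS i) (bS i)).
congr bounded_measurable; apply/funext => w.
by rewrite -mulmxE -mulmxA dotv_mulmx (family_sym famP).
Qed.

(** For the factor of one summand, Golden-Thompson reduces the exponential
    moment to a matrix that acts as a quadratic form, for which the second
    order bound holds in expectation, the first order term being centred. *)
Lemma Ex_euler_quad_le n i v : (0 < n)%N ->
  dotv v (Ex_mx P (fun w => euler_mx n (S i w)) *m v) <= (1 + g * s i) * dotv v v.
Proof.
move=> n0; have bE := entries_in_euler function_algebra_bounded n (bS i).
rewrite -Ex_quad; last by apply: entries_in_euler => //; exact: function_algebra_bounded.
have b1 : bounded_measurable (fun w => dotv v (S i w *m v)).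
  exact: (entries_in_quad function_algebra_bounded).
have b0 : bounded_measurable (fun _ : Omega => dotv v v).
  exact: bounded_measurable_cst.
have b01 := bounded_measurableD b0 b1.
apply: (@le_trans _ _ (Ex (fun w => dotv v v + dotv v (S i w *m v)
    + g * dotv (S i w *m v) (S i w *m v)))).
  apply: le_Ex => //.
  - apply: (entries_in_quad function_algebra_bounded).
    by apply: entries_in_euler => //; exact: function_algebra_bounded.
  - by apply: bounded_measurableD => //; exact: bounded_measurableZ.
  - move=> w; apply: euler_mx_quadratic => //; first exact: (family_sym famP).
    exact: (family_opbound famP).
rewrite !ExD//; last exact: bounded_measurableZ.
rewrite Ex_cst ExZ// Ex_quad//.
have -> : Ex_mx P (S i) = 0.
  by apply/matrixP => a b; rewrite !mxE; exact: (family_centred famP).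
rewrite mul0mx dotv0 addr0 mulrDl mul1r lerD2l -mulrA ler_wpM2l//.
exact: (family_var famP).
Qed.

Lemma Ex_euler_factor_le n (k : 'I_N) (W : Omega -> 'M[R]_d) : (0 < n)%N ->
  (forall w, (W w)^T = W w) -> entries_in (past Y k) W ->
  Ex (fun w => \tr (W w * W w * euler_mx n (S k w))) <=
  (1 + g * s k) * Ex (fun w => \tr (W w * W w)).
Proof.
move=> n0 symW pW; set M := Ex_mx P (fun w => euler_mx n (S k w)).
have algP := function_algebra_past Y k.
have algB := @function_algebra_bounded R _ Omega.
have pWW := entries_inM algP pW pW.
have bWW : entries_in bounded_measurable (fun w => W w * W w).
  by move=> a b; apply: past_bounded; exact: pWW.
have bE := entries_in_euler algB n (bS k).
have -> : Ex (fun w => \tr (W w * W w * euler_mx n (S k w))) =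
    Ex (fun w => \tr (W w * W w * M)).
  rewrite Ex_trace_mulr// mxtrace_mul_sum.
  under eq_fun do rewrite mxtrace_mul_sum.
  have bij i j : bounded_measurable
      (fun w => (W w * W w) i j * euler_mx n (S k w) j i).
    exact: bounded_measurableM.
  rewrite Ex_sum; last by move=> i; exact: bounded_measurable_sum.
  apply: eq_bigr => i _; rewrite Ex_sum//; apply: eq_bigr => j _.
  rewrite !mxE -(past_indep indepY (psi := fun x => euler_mx n (sigma k x) j i))//.
  apply: entries_in_euler; first exact: function_algebra_bounded.
  exact: (family_bounded famP).
rewrite -ExZ; last exact: (entries_in_trace algB).
apply: le_Ex.
- apply: (entries_in_trace algB); apply: (entries_inM algB) => //.
  exact: (entries_in_cst algB).
- by apply: bounded_measurableZ; exact: (entries_in_trace algB).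
- by move=> w; apply: mxtrace_sqr_mul_le => // v; exact: Ex_euler_quad_le.
Qed.


Let Z k w := \sum_(i < N | (i < k)%N) S i w.

Let symS i w : (S i w)^T = S i w. Proof. exact: (family_sym famP). Qed.

Let symZ k w : (Z k w)^T = Z k w.
Proof. by rewrite /Z raddf_sum /=; apply: eq_bigr => i _; exact: symS. Qed.

Let past_Z k : entries_in (past Y k) (Z k).
Proof.
apply: (entries_in_sum (function_algebra_past Y k)) => i ik a b.
apply: (@past_single _ _ _ P _ _ _ Y k i (fun x => sigma i x a b)) => //.
exact: (family_bounded famP).
Qed.

Let opboundZ k w : opbound (Z k w) (N%:R * L).
Proof.
have -> : N%:R * L = \sum_(i < N) L by rewrite sumr_const card_ord mulr_natl.
rewrite /Z big_mkcond; apply: opbound_sum => i.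
case: ifP => _; first exact: (family_opbound famP).
exact: opbound_le (@opbound0 _ _).
Qed.

Let bEuler n k : bounded_measurable (fun w => \tr (euler_mx n (Z k w))).
Proof.
apply: (@past_bounded _ _ _ P _ _ _ Y k).
apply: (entries_in_trace (function_algebra_past Y k)).
exact: (entries_in_euler (function_algebra_past Y k)).
Qed.

(** The error terms of the discretised Golden-Thompson inequality accumulate
    over the summands but remain of order 1 / n. *)
Lemma Ex_euler_sum_le k : (k <= N)%N -> exists2 K, 0 <= K & forall m,
  Ex (fun w => \tr (euler_mx (2 ^ m.+1) (Z k w))) <=
  d%:R * \prod_(i < N | (i < k)%N) (1 + g * s i) + K * (2 ^ m.+1)%:R^-1.
Proof.
elim: k => [_|k IH kN].
  exists 0 => // m; rewrite mul0r addr0 big_pred0// mulr1.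
  rewrite (_ : (fun w => _) = fun _ => d%:R) ?Ex_cst//; apply/funext => w.
  by rewrite /Z big_pred0// /euler_mx scaler0 addr0 expr1n mxtrace1.
have [K K0 hK] := IH (ltnW kN); pose j := Ordinal kN.
have ZE w : Z k.+1 w = Z k w + S j w.
  rewrite /Z (bigD1 j)//= addrC; congr (_ + _); apply: eq_bigl => i.
  by rewrite ltnS [in RHS]ltn_neqAle andbC -val_eqE.
have prodE : \prod_(i < N | (i < k.+1)%N) (1 + g * s i) =
    (1 + g * s j) * \prod_(i < N | (i < k)%N) (1 + g * s i).
  rewrite (bigD1 j)//=; congr (_ * _); apply: eq_bigl => i.
  by rewrite ltnS [in RHS]ltn_neqAle andbC -val_eqE.
set C := N%:R * L + L; have C0 : 0 <= C by rewrite addr_ge0// mulr_ge0.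
have f0 : 0 <= 1 + g * s j by rewrite addr_ge0// mulr_ge0.
exists ((1 + g * s j) * K + d%:R * (C ^+ 2 * expR (2 * C))).
  by rewrite addr_ge0 ?mulr_ge0// ?sqr_ge0 ?expR_ge0.
move=> m; set n := (2 ^ m.+1)%N; set c := n%:R^-1.
have n0 : (0 < n)%N by rewrite expn_gt0.
pose W w := (1 + c *: Z k w) ^+ (2 ^ m).
have WW w : euler_mx n (Z k w) = W w * W w.
  by rewrite /W -exprD addnn -mul2n -expnS.
have symW w : (W w)^T = W w.
  by rewrite trmxX linearD linearZ /= trmx1 symZ.
have pW : entries_in (past Y j) W.
  have algP := function_algebra_past Y k.
  apply: (entries_inX algP); apply: (entries_inD algP); first exact: entries_in_cst.
  exact: (entries_inZ algP).
have bG : bounded_measurable (fun w => \tr (W w * W w * euler_mx n (S j w))).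
  have algB := @function_algebra_bounded R _ Omega.
  have bW : entries_in bounded_measurable W.
    by move=> a b; apply: past_bounded; exact: pW.
  apply: (entries_in_trace algB); apply: (entries_inM algB).
    exact: (entries_inM algB).
  exact: (entries_in_euler algB).
have step := Ex_euler_factor_le n0 symW pW.
apply: (@le_trans _ _ (Ex (fun w => \tr (W w * W w * euler_mx n (S j w))
    + d%:R * (C ^+ 2 * expR (2 * C)) * c))).
  apply: le_Ex => //; first by apply: bounded_measurableD => //; exact: bounded_measurable_cst.
  move=> w; rewrite ZE -WW; apply: (euler_mx_golden_thompson (k := m.+1)) => //.
    by apply: opbound_le (opboundZ k w); rewrite lerDl.
  by apply: opbound_le (family_opbound famP j _); rewrite lerDr mulr_ge0.
rewrite ExD//; last exact: bounded_measurable_cst.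
rewrite Ex_cst [X in _ <= _ + X]mulrDl addrA lerD2r; apply: le_trans step _.
rewrite (_ : (fun w => \tr (W w * W w)) = fun w => \tr (euler_mx n (Z k w))); last first.
  by apply/funext => w; rewrite WW.
apply: le_trans (ler_wpM2l f0 (hK m)) _.
by rewrite prodE mulrDr !mulrA [d%:R * _]mulrC.
Qed.

End matrix_bernstein.

(** * Passage to the limit *)

Lemma function_algebra_measurable {R : realType} {disp : measure_display}
  {T : measurableType disp} :
  function_algebra (fun f : T -> R => measurable_fun setT f).
Proof.
by split; [exact: measurable_cst | exact: measurable_funD | exact: measurable_funM].
Qed.

Lemma measurable_opnorm_sym {R : realType} {disp : measure_display}
    {T : measurableType disp} {d : nat} (Z : T -> 'M[R]_d) :
  (forall x, (Z x)^T = Z x) ->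
  entries_in (fun f : T -> R => measurable_fun setT f) Z ->
  measurable_fun setT (fun x => opnorm (Z x)).
Proof.
move=> symZ mZ _; apply: (measurability _ (RGenOInfty.measurableE R)) => //.
move=> _ [_ [c ->] <-]; rewrite setTI.
have -> : (fun x => opnorm (Z x)) @^-1` `]c, +oo[%classic =
    ~` [set x | opnorm (Z x) <= c].
  by apply/seteqP; split => x /=; rewrite in_itv/= andbT ltNge => /negP.
apply: measurableC; have [c0|c0] := leP 0 c; last first.
  have -> : [set x | opnorm (Z x) <= c] = set0; last exact: measurable0.
  apply/seteqP; split => x //= h.
  by have := le_lt_trans h c0; rewrite ltNge opnorm_ge0.
have -> : [set x | opnorm (Z x) <= c] =
    \bigcap_j [set x | \tr (Z x ^+ j.*2) <= d%:R * c ^+ j.*2].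
  apply/seteqP; split => x /=.
    by move=> /(opnorm_sym_leP (symZ x) c0) h j _; exact: h.
  by move=> h; apply/(opnorm_sym_leP (symZ x) c0) => j; exact: h.
apply: bigcapT_measurable => j.
have algM := @function_algebra_measurable R _ T.
have mtr : measurable_fun setT (fun x => \tr (Z x ^+ j.*2)).
  exact: (entries_in_trace algM (entries_inX algM _ mZ)).
have := measurable_fun_ler mtr (measurable_cst (d%:R * c ^+ j.*2)).
by move=> /(_ measurableT [set true] I); rewrite setTI.
Qed.

Lemma le_of_vanishing_error {R : realType} (a b c K : R) :
  (forall m, a <= expR (c * (2 ^ m.+1)%:R^-1) * (b + K * (2 ^ m.+1)%:R^-1)) ->
  a <= b.
Proof.
move=> h; pose u m : R := (2 ^ m.+1)%:R^-1.
have u0 : u @ \oo --> (0 : R).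
  have -> : u = geometric (2^-1 : R) 2^-1.
    by apply/funext => m; rewrite /u /geometric /= natrX exprS invfM exprVn.
  by apply: cvg_geometric; rewrite ger0_norm//; lra.
have cv : (fun m => expR (c * u m) * (b + K * u m)) @ \oo --> expR (c * 0) * (b + K * 0).
  apply: cvgM.
    apply: continuous_cvg; first exact: continuous_expR.
    by apply: cvgM => //; exact: cvg_cst.
  by apply: cvgD; [exact: cvg_cst|apply: cvgM => //; exact: cvg_cst].
have -> : b = expR (c * 0) * (b + K * 0) by rewrite !mulr0 expR0 mul1r addr0.
apply: (cvgr_to_ge cv); apply: nearW => m; exact: h.
Qed.

Section matrix_bernstein.
Context {R : realType} {disp : measure_display} {Omega : measurableType disp}
  (P : probability Omega R) {disp' : measure_display}
  {T : measurableType disp'} {N d : nat} (Y : 'I_N -> {RV P >-> T}).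
Hypothesis indepY : mutually_independent Y.
Local Notation Ex := (Ex P).

Lemma bounded_expR_opnorm (Z : Omega -> 'M[R]_d) C : (forall w, (Z w)^T = Z w) ->
  entries_in bounded_measurable Z -> (forall w, opbound (Z w) C) -> 0 <= C ->
  bounded_measurable (fun w => expR (opnorm (Z w))).
Proof.
move=> symZ bZ hZ C0; split.
  apply: measurableT_comp => //; apply: measurable_opnorm_sym => // i j.
  by have [] := bZ i j.
exists (expR C) => w; rewrite ger0_norm ?expR_ge0// ler_expR.
exact: opnorm_le.
Qed.

(** The eigenvalues of both signs are caught by adding the moments of Z and
    - Z, whence the factor 2. *)
Lemma Ex_expR_opnorm_le (sigma : 'I_N -> T -> 'M[R]_d) (L : R) (s : 'I_N -> R) :
  (0 < d)%N -> bernstein_family Y sigma L s -> (forall i, 0 <= s i) ->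
  0 <= L -> L < 3 ->
  Ex (fun w => expR (opnorm (\sum_i sigma i (Y i w)))) <=
  2 * d%:R * expR ((2 * (1 - L / 3))^-1 * \sum_i s i).
Proof.
move=> d0 famP s0 L0 L3; set g := (2 * _)^-1.
have g0 : 0 <= g by rewrite invr_ge0; apply: mulr_ge0 => //; lra.
have famN : bernstein_family Y (fun i x => - sigma i x) L s.
  have := bernstein_familyZ (-1) famP; rewrite normrN1 mul1r.
  have -> : (fun i => (-1) ^+ 2 * s i) = s by apply/funext => i; rewrite sqrrN expr1n mul1r.
  congr bernstein_family; apply/funext => i; apply/funext => x.
  by rewrite scaleN1r.
have [K K0 hK] := Ex_euler_sum_le indepY famP s0 L0 L3 (leqnn N).
have [K' K'0 hK'] := Ex_euler_sum_le indepY famN s0 L0 L3 (leqnn N).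
pose Z w := \sum_i sigma i (Y i w).
have ZE w : \sum_(i < N | (i < N)%N) sigma i (Y i w) = Z w.
  by apply: eq_bigl => i; rewrite ltn_ord.
have ZNE w : \sum_(i < N | (i < N)%N) - sigma i (Y i w) = - Z w.
  by rewrite sumrN ZE.
have prodE : \prod_(i < N | (i < N)%N) (1 + g * s i) <= expR (g * \sum_i s i).
  rewrite mulr_sumr expR_sum.
  rewrite [leLHS](eq_bigl predT); last by move=> i; rewrite ltn_ord.
  apply: ler_prod => i _; rewrite addr_ge0 ?mulr_ge0//=.
  exact: expR_ge1Dx.
have symZ w : (Z w)^T = Z w.
  by rewrite /Z raddf_sum /=; apply: eq_bigr => i _; exact: (family_sym famP).
have bZ : entries_in bounded_measurable Z.
  apply: (entries_in_sum function_algebra_bounded) => i _ a b.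
  apply: (bounded_measurable_comp (phi := fun x => sigma i x a b)).
    exact: measurable_funPT.
  exact: (family_bounded famP).
pose C := \sum_(i < N) L; have C0 : 0 <= C by apply: sumr_ge0.
have hZ w : opbound (Z w) C.
  by apply: opbound_sum => i; exact: (family_opbound famP).
apply: (@le_of_vanishing_error _ _ _ (C ^+ 2) (K + K')) => m.
set n := (2 ^ m.+1)%N.
have n0 : (0 < n)%N by rewrite expn_gt0.
have n_even : ~~ odd n by rewrite /n expnS mul2n odd_double.
have bE (F : Omega -> 'M[R]_d) : entries_in bounded_measurable F ->
    bounded_measurable (fun w => \tr (euler_mx n (F w))).
  move=> bF; apply: (entries_in_trace function_algebra_bounded).
  exact: (entries_in_euler function_algebra_bounded).
have bNZ : entries_in bounded_measurable (fun w => - Z w).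
  exact: (entries_inN function_algebra_bounded).
apply: (@le_trans _ _ (Ex (fun w => expR (C ^+ 2 / n%:R) *
    (\tr (euler_mx n (Z w)) + \tr (euler_mx n (- Z w)))))).
  apply: le_Ex.
  - exact: bounded_expR_opnorm hZ C0.
  - by apply: bounded_measurableZ; apply: bounded_measurableD; exact: bE.
  - by move=> w; apply: expR_opnorm_le => //; [exact: symZ|exact: hZ].
rewrite ExZ; last by apply: bounded_measurableD; exact: bE.
rewrite ler_wpM2l ?expR_ge0// ExD; [|exact: bE..].
set prod := \prod_(i < N | (i < N)%N) (1 + g * s i) in prodE.
have hp : Ex (fun w => \tr (euler_mx n (Z w))) <= d%:R * prod + K * n%:R^-1.
  apply: le_trans (hK m); rewrite le_eqVlt; apply/orP; left; apply/eqP.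
  by congr Ex; apply/funext => w; rewrite ZE.
have hm : Ex (fun w => \tr (euler_mx n (- Z w))) <= d%:R * prod + K' * n%:R^-1.
  apply: le_trans (hK' m); rewrite le_eqVlt; apply/orP; left; apply/eqP.
  by congr Ex; apply/funext => w; rewrite ZNE.
apply: le_trans (lerD hp hm) _; rewrite mulrDl.
have := ler_wpM2l (ler0n R d) prodE; clear; lra.
Qed.

End matrix_bernstein.

(** * The matrix Bernstein inequalities *)

Lemma opnormZ_ge {R : realType} {d : nat} (A : 'M[R]_d) (t : R) :
  0 < t -> t * opnorm A <= opnorm (t *: A).
Proof.
move=> t0; rewrite mulrC -ler_pdivlMr//; apply: opnorm_le; last first.
  by rewrite divr_ge0 ?opnorm_ge0// ltW.
move=> u; have := opbound_opnorm (t *: A) u.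
rewrite -scalemxAl enormZ gtr0_norm// mulrAC ler_pdivlMr//.
by rewrite [t * _]mulrC.
Qed.

Section matrix_bernstein_inequalities.
Context {R : realType} {disp : measure_display} {Omega : measurableType disp}
  (P : probability Omega R) {disp' : measure_display}
  {T : measurableType disp'} {N d : nat} (Y : 'I_N -> {RV P >-> T}).
Hypothesis indepY : mutually_independent Y.
Context (sigma : 'I_N -> T -> 'M[R]_d) (L v : R) (s : 'I_N -> R).
Hypothesis d_gt0 : (0 < d)%N.
Hypothesis famP : bernstein_family Y sigma L s.
Hypothesis s_ge0 : forall i, 0 <= s i.
Hypothesis L_ge0 : 0 <= L.
Hypothesis v_ge : \sum_i s i <= v.
Hypothesis v_gt0 : 0 < v.
Local Notation Ex := (Ex P).

Let Z w := \sum_i sigma i (Y i w).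

Lemma family_sum_sym w : (Z w)^T = Z w.
Proof.
by rewrite /Z raddf_sum /=; apply: eq_bigr => i _; exact: (family_sym famP).
Qed.

Lemma family_sum_bounded : entries_in bounded_measurable Z.
Proof.
apply: (entries_in_sum function_algebra_bounded) => i _ a b.
apply: (bounded_measurable_comp (phi := fun x => sigma i x a b)).
  exact: measurable_funPT.
exact: (family_bounded famP).
Qed.

Lemma measurable_family_opnorm : measurable_fun setT (fun w => opnorm (Z w)).
Proof.
apply: measurable_opnorm_sym => [|i j]; first exact: family_sum_sym.
by have [] := family_sum_bounded i j.
Qed.

Let C := \sum_(i < N) L.

Let opnorm_C w : 0 <= opnorm (Z w) <= C.
Proof.
rewrite opnorm_ge0 opnorm_le//; last exact: sumr_ge0.
by apply: opbound_sum => i; exact: (family_opbound famP).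
Qed.

Lemma bounded_family_opnorm : bounded_measurable (fun w => opnorm (Z w)).
Proof.
split; first exact: measurable_family_opnorm.
by exists C => w; have /andP[? ?] := opnorm_C w; rewrite ger0_norm.
Qed.

Lemma bounded_expR_family_opnorm t : 0 <= t ->
  bounded_measurable (fun w => expR (t * opnorm (Z w))).
Proof.
move=> t0; split.
  apply: measurableT_comp => //; apply: measurable_funM => //.
  exact: measurable_family_opnorm.
exists (expR (t * C)) => w; rewrite ger0_norm ?expR_ge0// ler_expR ler_wpM2l//.
by case/andP: (opnorm_C w).
Qed.

(** The parametrisation of the exponent by a level a, with
    1 / t = v / a + L / 3, makes 1 - t L / 3 = t v / a and turns the bound on
    the logarithm of the moment into t a / 2. *)
Lemma bernstein_expR_le (a t : R) : 0 < a -> t = (v / a + L / 3)^-1 ->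
  Ex (fun w => expR (t * opnorm (Z w))) <= 2 * d%:R * expR (t * a / 2).
Proof.
move=> a0 tE; have va0 : 0 < v / a by rewrite divr_gt0.
have q0 : 0 < v / a + L / 3 by have := L_ge0; lra.
have t0 : 0 < t by rewrite tE invr_gt0.
have tq : t * (v / a + L / 3) = 1 by rewrite tE mulVf// gt_eqF.
have fam := bernstein_familyZ t famP; rewrite gtr0_norm// in fam.
have ts0 i : 0 <= t ^+ 2 * s i by rewrite mulr_ge0// sqr_ge0.
have tva : 0 < t * (v / a) by rewrite mulr_gt0.
have tL3 : t * L < 3.
  by move: tq; rewrite mulrDr mulrA => tq; lra.
have := Ex_expR_opnorm_le indepY d_gt0 fam ts0 (mulr_ge0 (ltW t0) L_ge0) tL3.
have -> : 1 - t * L / 3 = t * (v / a) by move: tq; rewrite mulrDr mulrA => tq; lra.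
move=> h; apply: le_trans (le_trans h _).
  apply: le_Ex; first exact: bounded_expR_family_opnorm (ltW t0).
    apply: (bounded_expR_opnorm (C := \sum_(i < N) (t * L))).
    - by move=> w; rewrite raddf_sum /=; apply: eq_bigr => i _; exact: (family_sym fam).
    - apply: (entries_in_sum function_algebra_bounded) => i _ b c.
      apply: (bounded_measurable_comp (phi := fun x => (t *: sigma i x) b c)).
        exact: measurable_funPT.
      exact: (family_bounded fam).
    - by move=> w; apply: opbound_sum => i; exact: (family_opbound fam).
    - by apply: sumr_ge0 => i _; rewrite mulr_ge0// ltW.
  move=> w; rewrite ler_expR; apply: le_trans (opnormZ_ge _ t0) _.
  by rewrite /Z scaler_sumr.
rewrite ler_wpM2l ?mulr_ge0// ler_expR -mulr_sumr.
have -> : t * a / 2 = (2 * (t * (v / a)))^-1 * (t ^+ 2 * v).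
  by field; rewrite !gt_eqF.
rewrite ler_wpM2l//; first by rewrite invr_ge0 mulr_ge0// ltW.
by rewrite ler_wpM2l ?sqr_ge0.
Qed.

(** Jensen's inequality for the logarithm, in the form of its tangent at c:
    t x <= ln c + e^(t x) / c - 1. *)
Lemma bernstein_expectation (a : R) : 0 < a ->
  Ex (fun w => opnorm (Z w)) <= ln (2 * d%:R) * (v / a + L / 3) + a / 2.
Proof.
move=> a0; set q := v / a + L / 3.
have q0 : 0 < q by have := L_ge0; have := divr_gt0 v_gt0 a0; rewrite /q; lra.
pose t := q^-1; have t0 : 0 < t by rewrite invr_gt0.
have d0 : 0 < 2 * d%:R :> R by rewrite mulr_gt0// ltr0n.
pose c := 2 * d%:R * expR (t * a / 2).
have c0 : 0 < c by rewrite mulr_gt0// expR_gt0.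
have lnc : ln c = ln (2 * d%:R) + t * a / 2.
  by rewrite /c (@lnM _ (2 * d%:R)) ?posrE ?expR_gt0// expRK.
have bexp := bounded_expR_family_opnorm (ltW t0).
have bnd1 : bounded_measurable (fun w => c^-1 * expR (t * opnorm (Z w))).
  exact: bounded_measurableZ.
have bnd2 : bounded_measurable
    (fun w => (ln c - 1) + c^-1 * expR (t * opnorm (Z w))).
  by apply: bounded_measurableD => //; exact: bounded_measurable_cst.
apply: (@le_trans _ _ (Ex (fun w => q *
    ((ln c - 1) + c^-1 * expR (t * opnorm (Z w)))))).
  apply: le_Ex; [exact: bounded_family_opnorm|exact: bounded_measurableZ|move=> w].
  have := expR_ge1Dx (t * opnorm (Z w) - ln c).
  rewrite expRD expRN lnK ?posrE// [_ / c]mulrC => h.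
  have zE : opnorm (Z w) = q * (t * opnorm (Z w)).
    by rewrite mulrA divff ?mul1r// gt_eqF.
  by rewrite [leLHS]zE ler_pM2l//; lra.
rewrite ExZ// ExD//; last exact: bounded_measurable_cst.
rewrite Ex_cst ExZ//.
have := bernstein_expR_le a0 (erefl t); rewrite -/c => h.
have h1 : c^-1 * Ex (fun w => expR (t * opnorm (Z w))) <= 1.
  by rewrite mulrC ler_pdivrMr// mul1r.
apply: (@le_trans _ _ (q * ln c)); first by rewrite ler_pM2l//; lra.
by rewrite lnc mulrDr mulrC lerD2l !mulrA divff ?mul1r// gt_eqF.
Qed.

(** Markov's inequality for e^(t x), in the pointwise form
    1 - e^(t (x - a)) <= 1_{x <= a}. *)
Lemma bernstein_tail (a eta : R) : 0 < a -> 0 < eta ->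
  ln (2 * d%:R / eta) * (v / a + L / 3) <= a / 2 ->
  ((1 - eta)%:E <= P [set w | (opnorm (Z w) <= a)%R])%E.
Proof.
move=> a0 eta0; set q := v / a + L / 3 => hq.
have q0 : 0 < q by have := L_ge0; have := divr_gt0 v_gt0 a0; rewrite /q; lra.
pose t := q^-1; have t0 : 0 < t by rewrite invr_gt0.
have d0 : 0 < 2 * d%:R :> R by rewrite mulr_gt0// ltr0n.
have mA : measurable [set w | opnorm (Z w) <= a].
  have := measurable_fun_ler measurable_family_opnorm (measurable_cst a).
  by move=> /(_ measurableT [set true] I); rewrite setTI.
have bexp := bounded_expR_family_opnorm (ltW t0).
have : 1 - eta <= Ex \1_[set w | opnorm (Z w) <= a].
  apply: (@le_trans _ _ (Ex (fun w => 1 + (- expR (- (t * a))) *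
      expR (t * opnorm (Z w))))).
    rewrite ExD; [|exact: bounded_measurable_cst|exact: bounded_measurableZ].
    rewrite Ex_cst ExZ// lerD2l mulNr lerN2.
    have := bernstein_expR_le a0 (erefl t).
    move=> /(ler_wpM2l (expR_ge0 (- (t * a)))) /le_trans; apply.
    rewrite mulrCA -expRD.
    have -> : - (t * a) + t * a / 2 = - (t * a / 2) by lra.
    rewrite expRN ler_pdivrMr ?expR_gt0// [eta * _]mulrC -ler_pdivrMr//.
    rewrite -[leLHS]lnK ?posrE ?divr_gt0// ler_expR -mulrA [t * _]mulrC.
    by rewrite /t ler_pdivlMr.
  apply: le_Ex.
  - by apply: bounded_measurableD; [exact: bounded_measurable_cst|exact: bounded_measurableZ].
  - exact: bounded_measurable_indic.
  move=> w; rewrite indicE mulNr -expRD; case: (boolP (w \in _)) => hw.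
    by rewrite gerBl expR_ge0.
  have : 1 <= expR (- (t * a) + t * opnorm (Z w)).
    rewrite -[leLHS]expR0 ler_expR addrC subr_ge0 ler_pM2l// ltW// ltNge.
    by apply/negP => h; move/negP: hw; apply; rewrite inE.
  by rewrite /=; lra.
rewrite Ex_indic// -lee_fin fineK//; exact: fin_num_measure.
Qed.

End matrix_bernstein_inequalities.

(** * Second moments from the density *)

Section density.
Context {R : realType} {disp : measure_display} {Omega : measurableType disp}
  (P : probability Omega R) {d : nat} (D : set 'cV[R]_d) (rho : 'cV[R]_d -> R)
  (X : {RV P >-> 'cV[R]_d}).
Hypotheses (mD : measurable D) (rhoP : density_on D rho)
  (Xrho : has_density D rho X).

Let mX : measurable_fun setT X. Proof. exact: measurable_funPT. Qed.

Let rho_integrable : (lebesgue_cV d).-integrable D (EFin \o rho).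
Proof.
case: rhoP => mrho rho0 rho1; apply/integrableP; split; first exact/measurable_EFinP.
rewrite (_ : \int[_]_(x in D) _ = 1)%E ?ltry// -rho1; apply: eq_integral => x.
by rewrite inE => Dx; rewrite /= ger0_norm ?rho0.
Qed.

Let density_integrable (psi : 'cV[R]_d -> R) : bounded_measurable psi ->
    (lebesgue_cV d).-integrable D (EFin \o (fun x => psi x * rho x)).
Proof.
move=> [mpsi [M hM]]; have [mrho _ _] := rhoP.
  apply: (@le_integrable _ _ _ _ _ mD _ (fun x => (`|M|%:E * (EFin \o rho) x)%E)).
  - apply/measurable_EFinP; apply: measurable_funM => //.
    exact: measurable_funS mpsi.
  - move=> x Dx /=; rewrite lee_fin !normrM normr_id ler_wpM2r//.
    exact: le_trans (hM x) (ler_norm M).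
  - exact: integrableZl.
Qed.

(** Both sides are continuous linear functionals of phi that agree on
    indicators. *)
Lemma Ex_density (phi : 'cV[R]_d -> R) : bounded_measurable phi ->
  Ex P (fun w => phi (X w)) = \int[lebesgue_cV d]_(x in D) (phi x * rho x).
Proof.
case: (rhoP) => mrho rho0 rho1 bphi.
have int := density_integrable.
have bX (psi : 'cV[R]_d -> R) : bounded_measurable psi ->
    bounded_measurable (fun w => psi (X w)).
  exact: bounded_measurable_comp.
apply/eqP; rewrite -subr_eq0; apply/eqP.
apply: (@functional_indic_eq0 _ _ _ (fun phi => Ex P (fun w => phi (X w)) -
  \int[lebesgue_cV d]_(x in D) (phi x * rho x)) 2) => //.
- move=> f g bf bg; rewrite ExD; [|exact: bX..].
  under eq_Rintegral do rewrite mulrDl.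
  rewrite RintegralD//; [ring|exact: int..].
- move=> c f bf; rewrite ExZ; last exact: bX.
  under eq_Rintegral do rewrite -mulrA.
  by rewrite RintegralZl//; [ring|exact: int].
- move=> f M bf hM; apply: le_trans (ler_normB _ _) _.
  rewrite mulr_natl mulr2n lerD//; first by apply: normr_Ex_le => //; exact: bX.
  apply: le_trans (le_normr_Rintegral mD (int _ bf)) _.
  have -> : M = \int[lebesgue_cV d]_(x in D) (M * rho x).
    by rewrite RintegralZl// /Rintegral rho1 mulr1.
  apply: le_Rintegral => //.
  + exact: (integrable_norm (int _ bf)).
  + by apply: int; exact: bounded_measurable_cst.
  + by move=> x Dx; rewrite normrM (ger0_norm (rho0 _ Dx)) ler_wpM2r ?rho0.
- move=> A mA; have [_ hX] := Xrho.
  have -> : Ex P (fun w => \1_A (X w)) = fine (P (X @^-1` A)).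
    rewrite -Ex_indic//; by rewrite -[_ @^-1` _]setTI; exact: mX.
  rewrite hX// integral_mkcondr /Rintegral; apply/eqP; rewrite subr_eq0; apply/eqP.
  congr fine; apply: eq_integral => x _; rewrite patchE indicE.
  by case: ifP; rewrite ?mul1r ?mul0r.
Qed.

(** Monotone convergence from the truncations of h^2, for which the
    expectation is given by the density. *)
Lemma density_second_moment (h : 'cV[R]_d -> R) : measurable_fun D h ->
  (\int[lebesgue_cV d]_(x in D) (h x ^+ 2 * rho x)%:E < +oo)%E ->
  (\int[P]_w (h (X w) ^+ 2)%:E < +oo)%E.
Proof.
move=> mh hfin; have [XD _] := Xrho; case: (rhoP) => mrho rho0 rho1.
set I := (\int[lebesgue_cV d]_(x in D) _)%E in hfin.
pose h' := h \_ D. have mh' : measurable_fun setT h' := (measurable_restrictT h mD).1 mh.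
have h'D x : D x -> h' x = h x by move=> Dx; rewrite /h' patchE mem_set.
pose g n w : \bar R := (Num.min (h' (X w) ^+ 2) n%:R)%:E.
have mtr n : measurable_fun setT (fun x => Num.min (h' x ^+ 2) n%:R).
  by apply: measurable_minr => //; exact: measurable_funX.
have mg n : measurable_fun setT (g n).
  by apply/measurable_EFinP; exact: (measurableT_comp (mtr n) mX).
have g0 n w : setT w -> (0 <= g n w)%E.
  by move=> _; rewrite lee_fin le_min sqr_ge0 ler0n.
have nd w : setT w -> {homo g^~ w : n m / (n <= m)%N >-> (n <= m)%E}.
  move=> _ n m nm; rewrite lee_fin le_min ge_min lexx /= ge_min ler_nat nm.
  by rewrite orbT.
have limg w : limn (g^~ w) = (h (X w) ^+ 2)%:E.
  apply/cvg_lim => //; rewrite -(h'D _ (XD w)).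
  apply: cvg_near_cst; near=> n; rewrite /g; congr _%:E; apply/min_idPl.
  by near: n; exact: nbhs_infty_ger.
have cv := @cvg_monotone_convergence _ _ _ P setT measurableT g mg g0 nd.
under eq_integral do rewrite -limg.
apply: le_lt_trans hfin.
apply: (cvge_to_le cv); apply: nearW => n.
have bn : bounded_measurable (fun x => Num.min (h' x ^+ 2) n%:R).
  split => //; exists n%:R => x; rewrite ger0_norm ?ge_min ?lexx ?orbT//.
  by rewrite le_min sqr_ge0 ler0n.
rewrite (Ex_EFin P (W := fun w => Num.min (h' (X w) ^+ 2) n%:R)); last first.
  exact: (bounded_measurable_comp _ bn).
rewrite (Ex_density bn) fineK; last first.
  by apply: integrable_fin_num => //; exact: density_integrable.
have [mbn _] := bn; apply: ge0_le_integral => //.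
- by move=> x Dx; rewrite lee_fin mulr_ge0 ?rho0// le_min sqr_ge0 ler0n.
- apply/measurable_EFinP; apply: measurable_funM => //.
  exact: measurable_funS mbn.
- by apply/measurable_EFinP; apply: measurable_funM => //; exact: measurable_funX.
- move=> x Dx; rewrite lee_fin ler_wpM2r ?rho0// h'D//.
  by rewrite ge_min lexx.
Unshelve. all: end_near. Qed.

End density.

(** * Rank-one matrices and centring *)

Section rank_one.
Context {R : realType} {d : nat}.
Implicit Types (a b v : 'cV[R]_d).

Lemma outer_mulmx a b v : a *m b^T *m v = dotv b v *: a.
Proof.
rewrite -mulmxA; apply/colP => i; rewrite !mxE big_ord1 mulrC; congr (_ * _).
by rewrite mxE; apply: eq_bigr => j _; rewrite mxE.
Qed.

Lemma trmx_outer a : (a *m a^T)^T = a *m a^T.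
Proof. by rewrite trmx_mul trmxK. Qed.

Lemma enorm_outer a v : enorm (a *m a^T *m v) <= enorm a ^+ 2 * enorm v.
Proof.
rewrite outer_mulmx enormZ expr2 mulrAC ler_wpM2r ?enorm_ge0//.
exact: cauchy_schwarz.
Qed.

(** With p = a - b and q = a + b, the difference a a^T - b b^T is the
    symmetric part of p q^T. *)
Lemma enorm_outer_sub a b v :
  enorm ((a *m a^T - b *m b^T) *m v) <= enorm (a - b) * enorm (a + b) * enorm v.
Proof.
have -> : (a *m a^T - b *m b^T) *m v =
    2^-1 *: (dotv (a + b) v *: (a - b) + dotv (a - b) v *: (a + b)).
  rewrite mulmxBl !outer_mulmx !dotvDl dotvNl.
  by apply/colP => i; rewrite !mxE; field.
rewrite enormZ ger0_norm//; have := enormD (dotv (a + b) v *: (a - b))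
  (dotv (a - b) v *: (a + b)).
rewrite !enormZ.
have := ler_wpM2r (enorm_ge0 (a - b)) (cauchy_schwarz (a + b) v).
have := ler_wpM2r (enorm_ge0 (a + b)) (cauchy_schwarz (a - b) v).
rewrite [enorm (a + b) * _ * _]mulrC [enorm (a - b) * enorm v * _]mulrAC mulrA.
lra.
Qed.

End rank_one.

Section centred.
Context {R : realType} {disp : measure_display} {Omega : measurableType disp}
  (P : probability Omega R) {d : nat}.

Lemma trmx_Ex_mx (F : Omega -> 'M[R]_d) : (forall w, (F w)^T = F w) ->
  (Ex_mx P F)^T = Ex_mx P F.
Proof.
move=> symF; apply/matrixP => i j; rewrite !mxE; congr Ex; apply/funext => w.
by rewrite -[in LHS]symF mxE.
Qed.

(** The vector y = (E F) u is tested against itself: |y|^2 = E (y . F u). *)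
Lemma opbound_Ex_mx (F : Omega -> 'M[R]_d) (B : R) : 0 <= B ->
  entries_in bounded_measurable F -> (forall w, opbound (F w) B) ->
  opbound (Ex_mx P F) B.
Proof.
move=> B0 bF hF u; set y := Ex_mx P F *m u.
have [y0|y0] := eqVneq (enorm y) 0; first by rewrite y0 mulr_ge0 ?enorm_ge0.
have y_gt0 : 0 < enorm y by rewrite lt_def y0 enorm_ge0.
rewrite -(ler_pM2l y_gt0) -expr2 enorm_sqr {2}/y -Ex_quad// -[leRHS](Ex_cst P).
apply: le_Ex => [||w]; last 1 first.
- apply: le_trans (ler_norm _) _; apply: le_trans (cauchy_schwarz _ _) _.
  by rewrite ler_wpM2l ?enorm_ge0//; exact: hF.
- exact: (entries_in_quad function_algebra_bounded).
- exact: bounded_measurable_cst.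
Qed.

Context {disp' : measure_display} {T : measurableType disp'} {N : nat}
  (Y : 'I_N -> {RV P >-> T}).

(** Centring at most doubles the uniform bound and does not increase the
    second moment. *)
Lemma bernstein_family_centred (M : 'I_N -> T -> 'M[R]_d) (c B V : 'I_N -> R)
    (L : R) :
  (forall i x, (M i x)^T = M i x) ->
  (forall i, entries_in bounded_measurable (M i)) ->
  (forall i x, opbound (M i x) (B i)) -> (forall i, 0 <= B i) ->
  (forall i, 0 <= c i) ->
  (forall i, c i * (2 * B i) <= L) ->
  (forall i v, Ex P (fun w => dotv (M i (Y i w) *m v) (M i (Y i w) *m v))
     <= V i * dotv v v) ->
  bernstein_family Y
    (fun i x => c i *: (Ex_mx P (fun w => M i (Y i w)) - M i x)) L
    (fun i => c i ^+ 2 * V i).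
Proof.
move=> symM bM hM B0 c0 hL hV.
have algB := @function_algebra_bounded R.
have bMY i : entries_in bounded_measurable (fun w => M i (Y i w)).
  move=> a b; apply: (bounded_measurable_comp (phi := fun x => M i x a b)) => //.
  exact: bM.
split.
- by move=> i x; rewrite linearZ linearB /= symM trmx_Ex_mx.
- move=> i; apply: (entries_inZ (algB _ _)); apply: (entries_inB (algB _ _)) => //.
  exact: (entries_in_cst (algB _ _)).
- move=> i x; apply: opbound_le (hL i) _.
  rewrite -[X in X * _](ger0_norm (c0 i)) mulr_natl mulr2n.
  apply: (opboundZ (c i)); apply: opboundD; last exact: opboundN.
  exact: opbound_Ex_mx.
- move=> i a b; under eq_fun do rewrite !mxE.
  rewrite ExZ; last first.
    by apply: bounded_measurableB; [exact: bounded_measurable_cst|exact: bMY].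
  rewrite ExB; [|exact: bounded_measurable_cst|exact: bMY].
  by rewrite Ex_cst subrr mulr0.
- move=> i v; set E := Ex_mx P _; set y := E *m v.
  have b1 : bounded_measurable (fun w => dotv y (M i (Y i w) *m v)).
    exact: (entries_in_quad (algB _ _)).
  have b2 : bounded_measurable
      (fun w => dotv (M i (Y i w) *m v) (M i (Y i w) *m v)).
    have := entries_in_quad (algB _ _) v v (entries_inM (algB _ _) (bMY i) (bMY i)).
    congr bounded_measurable; apply/funext => w.
    by rewrite -mulmxE -mulmxA dotv_mulmx symM.
  rewrite (_ : (fun w => _) = fun w => c i ^+ 2 * (dotv y y
      + (- 2 * dotv y (M i (Y i w) *m v)
         + dotv (M i (Y i w) *m v) (M i (Y i w) *m v)))); last first.
    apply/funext => w; rewrite -scalemxAl dotvZl dotvZr mulrA -expr2 mulmxBl -/y.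
    by rewrite !dotvDl !dotvDr !dotvNl !dotvNr (dotvC _ y); ring.
  rewrite ExZ; last first.
    apply: bounded_measurableD; first exact: bounded_measurable_cst.
    by apply: bounded_measurableD => //; exact: bounded_measurableZ.
  rewrite ExD; [|exact: bounded_measurable_cst|]; last first.
    by apply: bounded_measurableD => //; exact: bounded_measurableZ.
  rewrite ExD//; last exact: bounded_measurableZ.
  rewrite Ex_cst ExZ// Ex_quad// -/E -/y -mulrA ler_wpM2l ?sqr_ge0//.
  have := hV i v; have := dotv_ge0 y; lra.
Qed.

End centred.

(** * Moments of the two kinds of samples *)

Section bounded_gradients.
Context {R : realType} {disp : measure_display} {Omega : measurableType disp}
  (P : probability Omega R) {d : nat}.
Context (a b : 'cV[R]_d -> 'cV[R]_d) (beta theta r : R).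
Hypotheses (beta_ge0 : 0 <= beta) (theta_ge0 : 0 <= theta) (r_ge0 : 0 <= r).
Hypothesis bma : forall i, bounded_measurable (fun x => a x i 0).
Hypothesis bmb : forall i, bounded_measurable (fun x => b x i 0).
Hypothesis a_le : forall x, enorm (a x) <= beta * r.
Hypothesis ab_le : forall x, enorm (a x - b x) <= theta * r.

Definition control_mx x : 'M[R]_d := a x *m (a x)^T - b x *m (b x)^T.
Definition lowfi_mx x : 'M[R]_d := b x *m (b x)^T.

Lemma enorm_gradient_sum_le x : enorm (a x + b x) <= 2 * enorm (a x) + theta * r.
Proof.
have -> : a x + b x = 2 *: a x - (a x - b x).
  by apply/colP => i; rewrite !mxE; ring.
have := enormD (2 *: a x) (- (a x - b x)).
by rewrite enormN enormZ ger0_norm//; have := ab_le x; lra.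
Qed.

Lemma enorm_lowfi_le x : enorm (b x) <= enorm (a x) + theta * r.
Proof.
have -> : b x = a x - (a x - b x) by apply/colP => i; rewrite !mxE; ring.
have := enormD (a x) (- (a x - b x)).
by rewrite enormN; have := ab_le x; lra.
Qed.

Lemma opbound_control x : opbound (control_mx x) (theta * (2 * beta + theta) * r ^+ 2).
Proof.
move=> v; apply: le_trans (enorm_outer_sub _ _ _) _.
rewrite ler_wpM2r ?enorm_ge0//.
have -> : theta * (2 * beta + theta) * r ^+ 2 = theta * r * ((2 * beta + theta) * r).
  by ring.
rewrite ler_pM ?enorm_ge0 ?ab_le//; have := enorm_gradient_sum_le x; have := a_le x; lra.
Qed.

Lemma opbound_lowfi x : opbound (lowfi_mx x) ((theta + beta) ^+ 2 * r ^+ 2).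
Proof.
move=> v; apply: le_trans (enorm_outer _ _) _.
rewrite ler_wpM2r ?enorm_ge0// -exprMn lerXn2r ?nnegrE ?enorm_ge0//.
  by rewrite mulr_ge0// addr_ge0.
have := enorm_lowfi_le x; have := a_le x; lra.
Qed.

Lemma entries_in_outer (u : 'cV[R]_d -> 'cV[R]_d) :
  (forall i, bounded_measurable (fun x => u x i 0)) ->
  entries_in bounded_measurable (fun x => u x *m (u x)^T).
Proof.
move=> bu i j.
under eq_fun do rewrite !mxE big_ord1 [_^T _ _]mxE.
exact: bounded_measurableM.
Qed.

Lemma entries_in_control : entries_in bounded_measurable control_mx.
Proof.
by apply: (entries_inB function_algebra_bounded); exact: entries_in_outer.
Qed.

Lemma entries_in_lowfi : entries_in bounded_measurable lowfi_mx.
Proof. exact: entries_in_outer. Qed.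

Lemma bounded_sqnorm (u : 'cV[R]_d -> 'cV[R]_d) :
  (forall i, bounded_measurable (fun x => u x i 0)) ->
  bounded_measurable (fun x => dotv (u x) (u x)).
Proof.
by move=> bu; apply: bounded_measurable_sum => i _; exact: bounded_measurableM.
Qed.

Context (X : Omega -> 'cV[R]_d).
Hypothesis mX : measurable_fun setT X.
Hypothesis X_moment : Ex P (fun w => dotv (a (X w)) (a (X w))) = r ^+ 2.

(** The cross term 2 |a| r of the square is replaced by |a|^2 + r^2, which
    has the same bound after taking expectations. *)
Lemma Ex_sqr_shift_le (c e : R) (W : Omega -> R) :
  bounded_measurable W -> 0 <= c -> 0 <= e ->
  (forall w, W w <= e * (c * enorm (a (X w)) + theta * r) ^+ 2) ->
  Ex P W <= e * ((c + theta) ^+ 2 * r ^+ 2).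
Proof.
move=> bW c0 e0 hW.
have ba := bounded_measurable_comp mX (bounded_sqnorm bma).
pose U w := c * (c + theta) * dotv (a (X w)) (a (X w)).
have bU : bounded_measurable U by exact: bounded_measurableZ.
have bU' : bounded_measurable (fun w => U w + theta * (c + theta) * r ^+ 2).
  by apply: bounded_measurableD => //; exact: bounded_measurable_cst.
apply: (@le_trans _ _ (Ex P (fun w => e * (U w + theta * (c + theta) * r ^+ 2)))).
  apply: le_Ex => //; first exact: bounded_measurableZ.
  move=> w; apply: le_trans (hW w) _; rewrite ler_wpM2l// /U -enorm_sqr.
  have := mulr_ge0 (mulr_ge0 c0 theta_ge0) (sqr_ge0 (enorm (a (X w)) - r)).
  by nra.
rewrite ExZ// ExD//; last exact: bounded_measurable_cst.
rewrite Ex_cst [Ex P U]ExZ// X_moment ler_wpM2l//.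
by rewrite le_eqVlt; apply/orP; left; apply/eqP; ring.
Qed.

Let bquad (M : 'cV[R]_d -> 'M[R]_d) v : (forall x, (M x)^T = M x) ->
  entries_in bounded_measurable M ->
  bounded_measurable (fun w => dotv (M (X w) *m v) (M (X w) *m v)).
Proof.
move=> symM bM.
have := bounded_measurable_comp mX (entries_in_quad function_algebra_bounded v v
  (entries_inM function_algebra_bounded bM bM)).
congr bounded_measurable; apply/funext => w.
by rewrite -mulmxE -mulmxA dotv_mulmx symM.
Qed.

Lemma control_sym x : (control_mx x)^T = control_mx x.
Proof. by rewrite linearB /= !trmx_outer. Qed.

Lemma Ex_control_le v :
  Ex P (fun w => dotv (control_mx (X w) *m v) (control_mx (X w) *m v)) <=
  theta ^+ 2 * (2 + theta) ^+ 2 * r ^+ 4 * dotv v v.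
Proof.
have -> : theta ^+ 2 * (2 + theta) ^+ 2 * r ^+ 4 * dotv v v =
  (theta * r) ^+ 2 * dotv v v * ((2 + theta) ^+ 2 * r ^+ 2) by ring.
apply: Ex_sqr_shift_le => //.
- by apply: bquad; [exact: control_sym|exact: entries_in_control].
- by rewrite mulr_ge0 ?sqr_ge0 ?dotv_ge0.
move=> w; rewrite -!enorm_sqr -!exprMn lerXn2r ?nnegrE ?enorm_ge0//.
  by rewrite !mulr_ge0 ?addr_ge0 ?mulr_ge0 ?enorm_ge0.
apply: le_trans (enorm_outer_sub _ _ _) _.
rewrite [leRHS]mulrAC ler_wpM2r ?enorm_ge0// ler_pM ?enorm_ge0 ?ab_le//.
exact: enorm_gradient_sum_le.
Qed.

Lemma Ex_lowfi_le v :
  Ex P (fun w => dotv (lowfi_mx (X w) *m v) (lowfi_mx (X w) *m v)) <=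
  (theta + beta) ^+ 2 * (1 + theta) ^+ 2 * r ^+ 4 * dotv v v.
Proof.
have -> : (theta + beta) ^+ 2 * (1 + theta) ^+ 2 * r ^+ 4 * dotv v v =
  ((theta + beta) * r) ^+ 2 * dotv v v * ((1 + theta) ^+ 2 * r ^+ 2) by ring.
apply: Ex_sqr_shift_le => //.
- by apply: bquad; [move=> x; exact: trmx_outer|exact: entries_in_lowfi].
- by rewrite mulr_ge0 ?sqr_ge0 ?dotv_ge0.
move=> w; rewrite -!enorm_sqr -!exprMn lerXn2r ?nnegrE ?enorm_ge0//.
  by rewrite !mulr_ge0 ?addr_ge0 ?mulr_ge0 ?enorm_ge0.
apply: le_trans (enorm_outer _ _) _.
rewrite [leRHS]mulrAC ler_wpM2r ?enorm_ge0// expr2 mul1r.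
have h := enorm_lowfi_le (X w); rewrite ler_pM ?enorm_ge0//.
by have := a_le (X w); lra.
Qed.

End bounded_gradients.

(** * The estimator for bounded gradients *)

Section bounded_estimator.
Context {R : realType} {disp : measure_display} {Omega : measurableType disp}
  (P : probability Omega R) {d : nat}.
Context (a b : 'cV[R]_d -> 'cV[R]_d) (beta theta r : R).
Hypotheses (d_gt0 : (0 < d)%N) (beta_gt0 : 0 < beta) (theta_gt0 : 0 < theta)
  (r_gt0 : 0 < r).
Hypothesis bma : forall i, bounded_measurable (fun x => a x i 0).
Hypothesis bmb : forall i, bounded_measurable (fun x => b x i 0).
Hypothesis a_le : forall x, enorm (a x) <= beta * r.
Hypothesis ab_le : forall x, enorm (a x - b x) <= theta * r.
Context (X : {RV P >-> 'cV[R]_d}) (m1 m2 : nat)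
  (Y : 'I_(m1 + m2) -> {RV P >-> 'cV[R]_d}).
Hypotheses (m1_gt0 : (0 < m1)%N) (m2_gt0 : (0 < m2)%N).
Hypothesis YX : forall i (A : set 'cV[R]_d), measurable A ->
  P (Y i @^-1` A) = P (X @^-1` A).
Hypothesis indepY : mutually_independent Y.
Hypothesis X_moment : Ex P (fun w => dotv (a (X w)) (a (X w))) = r ^+ 2.
Hypothesis m2_ge : m1%:R * Num.max
       ((theta + beta) ^+ 2 * (1 + theta) ^+ 2
          / (theta ^+ 2 * (2 + theta) ^+ 2))
       ((theta + beta) ^+ 2 / (theta * (2 * beta + theta))) <= m2%:R.

Let M (i : 'I_(m1 + m2)) := if fintype.split i is inl _ then control_mx a b else lowfi_mx b.
Let m (i : 'I_(m1 + m2)) := if fintype.split i is inl _ then m1 else m2.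
Let B (i : 'I_(m1 + m2)) := if fintype.split i is inl _
  then theta * (2 * beta + theta) * r ^+ 2 else (theta + beta) ^+ 2 * r ^+ 2.
Let V (i : 'I_(m1 + m2)) := if fintype.split i is inl _
  then theta ^+ 2 * (2 + theta) ^+ 2 * r ^+ 4
  else (theta + beta) ^+ 2 * (1 + theta) ^+ 2 * r ^+ 4.
Let L := 2 * theta * (2 * beta + theta) * r ^+ 2 / m1%:R.
(* the factor 2 of L comes from centring, that of v from the two groups *)
Let v := 2 * theta ^+ 2 * (2 + theta) ^+ 2 * r ^+ 4 / m1%:R.

Let mY i : measurable_fun setT (Y i). Proof. exact: measurable_funPT. Qed.

Let m1R_gt0 : 0 < m1%:R :> R. Proof. by rewrite ltr0n. Qed.
Let m2R_gt0 : 0 < m2%:R :> R. Proof. by rewrite ltr0n. Qed.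

(** The first term of the maximum in the condition on m2 compares the two
    variances, the second one the two uniform bounds. *)
Let var_ratio : (theta + beta) ^+ 2 * (1 + theta) ^+ 2 / m2%:R <=
  theta ^+ 2 * (2 + theta) ^+ 2 / m1%:R.
Proof.
have t0 : 0 < theta ^+ 2 * (2 + theta) ^+ 2.
  by have := theta_gt0 => t0; rewrite mulr_gt0// exprn_gt0//; lra.
have := m2_ge; rewrite maxr_pMr ?ler0n// ge_max => /andP[h _].
rewrite ler_pdivrMr// [leRHS]mulrAC ler_pdivlMr//.
by move: h; rewrite mulrA ler_pdivrMr// [leLHS]mulrC [leRHS]mulrC.
Qed.

Let bound_ratio : (theta + beta) ^+ 2 / m2%:R <= theta * (2 * beta + theta) / m1%:R.
Proof.
have t0 : 0 < theta * (2 * beta + theta).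
  by move: theta_gt0 beta_gt0 => t0 b0; rewrite mulr_gt0//; lra.
have := m2_ge; rewrite maxr_pMr ?ler0n// ge_max => /andP[_ h].
rewrite ler_pdivrMr// [leRHS]mulrAC ler_pdivlMr//.
by move: h; rewrite mulrA ler_pdivrMr// [leLHS]mulrC [leRHS]mulrC.
Qed.

Let family : bernstein_family Y
  (fun i x => (m i)%:R^-1 *: (Ex_mx P (fun w => M i (Y i w)) - M i x)) L
  (fun i => (m i)%:R^-1 ^+ 2 * V i).
Proof.
move: (ltW beta_gt0) (ltW theta_gt0) (ltW r_gt0) => beta0 theta0 r0.
apply: (bernstein_family_centred (B := B)); rewrite /M /m /B /V /L.
- move=> i x; case: fintype.split => _; first exact: control_sym.
  exact: trmx_outer.
- move=> i; case: fintype.split => _; first exact: entries_in_control.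
  exact: entries_in_lowfi.
- move=> i x; case: fintype.split => _; first exact: opbound_control.
  exact: opbound_lowfi.
- by move=> i; case: fintype.split => _; rewrite !mulr_ge0 ?sqr_ge0 ?addr_ge0 ?mulr_ge0.
- by move=> i; rewrite invr_ge0.
- move=> i; case: fintype.split => _.
    by rewrite le_eqVlt; apply/orP; left; apply/eqP; ring.
  have := ler_wpM2r (sqr_ge0 r) bound_ratio; lra.
- have law i (phi : 'cV[R]_d -> R) : bounded_measurable phi ->
      Ex P (fun w => phi (Y i w)) = Ex P (fun w => phi (X w)).
    by move=> bphi; apply: eq_law_Ex => //; exact: YX.
  have Y_moment i : Ex P (fun w => dotv (a (Y i w)) (a (Y i w))) = r ^+ 2.
    by rewrite (law i (fun x => dotv (a x) (a x))) ?X_moment//; exact: bounded_sqnorm.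
  move=> i u; case: fintype.split => _.
    exact: (Ex_control_le theta0 r0 bma bmb ab_le (mY i) (Y_moment i)).
  exact: (Ex_lowfi_le beta0 theta0 r0 bma bmb a_le ab_le (mY i) (Y_moment i)).
Qed.

Let H := Ex_mx P (fun w => a (X w) *m (a (X w))^T).

Let splitl (i : 'I_m1) : fintype.split (lshift m2 i) = inl i.
Proof. exact: (@unsplitK m1 m2 (inl i)). Qed.

Let splitr (i : 'I_m2) : fintype.split (rshift m1 i) = inr i.
Proof. exact: (@unsplitK m1 m2 (inr i)). Qed.

Let Ex_mx_law (F : 'cV[R]_d -> 'M[R]_d) i : entries_in bounded_measurable F ->
  Ex_mx P (fun w => F (Y i w)) = Ex_mx P (fun w => F (X w)).
Proof.
move=> bF; apply/matrixP => j k; rewrite !mxE.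
apply: (@eq_law_Ex _ _ _ P _ _ _ _ (fun x => F x j k)) => //.
exact: YX.
Qed.

Let HE : H = Ex_mx P (fun w => control_mx a b (X w)) + Ex_mx P (fun w => lowfi_mx b (X w)).
Proof.
apply/matrixP => j k; rewrite !mxE -ExD.
- by congr Ex; apply/funext => w; rewrite !mxE subrK.
- apply: (bounded_measurable_comp (phi := fun x => control_mx a b x j k)).
    exact: measurable_funPT.
  exact: entries_in_control.
- apply: (bounded_measurable_comp (phi := fun x => lowfi_mx b x j k)).
    exact: measurable_funPT.
  exact: entries_in_lowfi.
Qed.

(** The estimation error is a sum of independent centred matrices, one for
    each sample. *)
Lemma mf_estimator_error w : H - mf_estimator a b Y w =
  \sum_i (m i)%:R^-1 *: (Ex_mx P (fun w => M i (Y i w)) - M i (Y i w)).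
Proof.
have avg n (E : 'M[R]_d) (F : 'I_n -> 'M[R]_d) : (0 < n)%N ->
    \sum_(i < n) n%:R^-1 *: (E - F i) = E - n%:R^-1 *: \sum_(i < n) F i.
  move=> n0; rewrite -scaler_sumr sumrB sumr_const card_ord scalerBr.
  rewrite -scalerMnr scalerMnl -[X in X *: E]mulr_natr mulVf ?scale1r//.
  by rewrite pnatr_eq0 -lt0n.
rewrite big_split_ord /= /M /m.
under eq_bigr do rewrite splitl (Ex_mx_law _ (entries_in_control bma bmb)).
under [X in _ = _ + X]eq_bigr do rewrite splitr (Ex_mx_law _ (entries_in_lowfi bmb)).
rewrite !avg// HE /mf_estimator opprD addrACA.
by [].
Qed.

Let s_ge0 i : 0 <= (m i)%:R^-1 ^+ 2 * V i.
Proof.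
move: (ltW beta_gt0) (ltW theta_gt0) (ltW r_gt0) => beta0 theta0 r0.
apply: mulr_ge0; first exact: sqr_ge0.
by rewrite /V; case: fintype.split => _; rewrite !mulr_ge0 ?exprn_ge0 ?addr_ge0.
Qed.

Let v_ge : \sum_i (m i)%:R^-1 ^+ 2 * V i <= v.
Proof.
rewrite big_split_ord /= /m /V.
under eq_bigr do rewrite splitl.
under [X in _ + X <= _]eq_bigr do rewrite splitr.
have avg n (x : R) : (0 < n)%N -> \sum_(i < n) n%:R^-1 ^+ 2 * x = x / n%:R.
  move=> n0; rewrite sumr_const card_ord -mulr_natl; field.
  by rewrite pnatr_eq0 -lt0n.
rewrite !avg//.
have r40 : 0 <= r ^+ 4 by rewrite exprn_ge0// ltW.
have := ler_wpM2r r40 var_ratio; rewrite /v; lra.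
Qed.

Let v_gt0 : 0 < v.
Proof.
have t2 : 0 < 2 + theta by have := theta_gt0; lra.
by rewrite divr_gt0// !mulr_gt0// exprn_gt0.
Qed.

Let L_ge0 : 0 <= L.
Proof.
move: (ltW beta_gt0) (ltW theta_gt0) (ltW r_gt0) => beta0 theta0 r0.
by rewrite divr_ge0// !mulr_ge0 ?addr_ge0 ?mulr_ge0 ?sqr_ge0.
Qed.

Let errorE : (fun w => opnorm (H - mf_estimator a b Y w)) = (fun w => opnorm
  (\sum_i (m i)%:R^-1 *: (Ex_mx P (fun w => M i (Y i w)) - M i (Y i w)))).
Proof. by apply/funext => w; rewrite mf_estimator_error. Qed.

Lemma bounded_measurable_error :
  bounded_measurable (fun w => opnorm (H - mf_estimator a b Y w)).
Proof. by rewrite errorE; exact: (bounded_family_opnorm family L_ge0). Qed.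

Lemma Ex_error_le (e : R) : 0 < e ->
  Ex P (fun w => opnorm (H - mf_estimator a b Y w)) <=
  ln (2 * d%:R) * (v / e + L / 3) + e / 2.
Proof.
rewrite errorE.
exact: (bernstein_expectation indepY d_gt0 family s_ge0 L_ge0 v_ge v_gt0).
Qed.

Lemma error_tail_le (e eta : R) : 0 < e -> 0 < eta ->
  ln (2 * d%:R / eta) * (v / e + L / 3) <= e / 2 ->
  ((1 - eta)%:E <= P [set w | (opnorm (H - mf_estimator a b Y w) <= e)%R])%E.
Proof.
move=> e0 eta0 h.
have := bernstein_tail indepY d_gt0 family s_ge0 L_ge0 v_ge v_gt0 e0 eta0 h.
by have /(congr1 (fun f => [set w | f w <= e])) -> := errorE.
Qed.

End bounded_estimator.

(** * Sample sizes and truncation *)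

Section arithmetic.
Context {R : realType} (h delta theta beta eps m l : R).
Hypotheses (h_gt0 : 0 < h) (delta_ge0 : 0 <= delta) (theta_gt0 : 0 < theta)
  (eps_gt0 : 0 < eps) (m_gt0 : 0 < m) (l_ge0 : 0 <= l).

Let v := 2 * theta ^+ 2 * (2 + theta) ^+ 2 * (delta * h) ^+ 2 / m.
Let L := 2 * theta * (2 * beta + theta) * (delta * h) / m.

Let v_level : l * (v / (eps * h)) = eps * h / 2 *
  (eps ^- 2 * delta * theta * l * (4 * delta * theta * (2 + theta) ^+ 2) / m).
Proof. by rewrite /v; field; rewrite !gt_eqF. Qed.

Let L_level : l * (L / 3) = eps ^+ 2 * h *
  (eps ^- 2 * delta * theta * l * (2 / 3 * (2 * beta + theta)) / m).
Proof. by rewrite /L; field; rewrite !gt_eqF. Qed.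

(** In bernstein_expectation the level eps h costs eps h / 2, the variance
    another eps h / 2, and the uniform bound eps^2 h. *)
Lemma expectation_sample_size :
  eps ^- 2 * delta * theta * l
    * Num.max (4 * delta * theta * (2 + theta) ^+ 2)
              (2 / 3 * (2 * beta + theta)) <= m ->
  l * (v / (eps * h) + L / 3) + eps * h / 2 <= (eps + eps ^+ 2) * h.
Proof.
have f0 : 0 <= eps ^- 2 * delta * theta * l.
  by rewrite !mulr_ge0// ?invr_ge0 ?exprn_ge0// ltW.
rewrite maxr_pMr// ge_max => /andP[].
rewrite -[m in X in X -> _]mul1r -ler_pdivrMr// => c1.
rewrite -[m in X in X -> _]mul1r -ler_pdivrMr// => c2.
rewrite mulrDr v_level L_level.
have e1 : 0 <= eps * h / 2 by rewrite divr_ge0// mulr_ge0// ltW.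
have e2 : 0 <= eps ^+ 2 * h by rewrite mulr_ge0 ?exprn_ge0// ltW.
have := ler_wpM2l e1 c1; have := ler_wpM2l e2 c2; lra.
Qed.

Lemma tail_sample_size :
  eps ^- 2 * delta * theta * l
    * (4 * delta * theta * (2 + theta) ^+ 2
       + 4 / 3 * eps * (2 * beta + theta)) <= m ->
  l * (v / (eps * h) + L / 3) <= eps * h / 2.
Proof.
rewrite -[m in X in X -> _]mul1r -ler_pdivrMr// => c1.
have e1 : 0 <= eps * h / 2 by rewrite divr_ge0// mulr_ge0// ltW.
apply: le_trans (le_trans (ler_wpM2l e1 c1) _); last by rewrite mulr1.
rewrite mulrDr v_level L_level le_eqVlt; apply/orP; left; apply/eqP.
by field; rewrite !gt_eqF.
Qed.

End arithmetic.

Lemma measurable_comp_on {R : realType} {disp disp' : measure_display}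
    {Omega : measurableType disp} {T : measurableType disp'} (D : set T)
    (h : T -> R) (Z : Omega -> T) : measurable D -> measurable_fun D h ->
  measurable_fun setT Z -> (forall w, D (Z w)) ->
  measurable_fun setT (fun w => h (Z w)).
Proof.
move=> mD mh mZ ZD.
have := measurableT_comp ((measurable_restrictT h mD).1 mh) mZ.
congr measurable_fun; apply/funext => w /=.
by rewrite patchE mem_set.
Qed.

Lemma ae_eq_prob {R : realType} {disp : measure_display}
    {Omega : measurableType disp} (P : probability Omega R) (A B : set Omega) :
  measurable A -> measurable B -> {ae P, forall w, A w <-> B w} -> P A = P B.
Proof.
move=> mA mB AB; rewrite -[A]setIT -[B]setIT -!integral_indic//.
apply: ae_eq_integral => //.
- by apply/measurable_EFinP; exact: measurable_indic.
- by apply/measurable_EFinP; exact: measurable_indic.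
- apply: filterS AB => w AB _ /=; congr _%:E; rewrite !indicE.
  by congr (_%:R); congr nat_of_bool; apply/idP/idP; rewrite !inE => /AB.
Qed.

Section truncation.
Context {R : realType} {disp : measure_display} {Omega : measurableType disp}
  (P : probability Omega R) {d : nat} (D : set 'cV[R]_d) (mD : measurable D).
Implicit Types (u : 'cV[R]_d -> 'cV[R]_d) (G : set 'cV[R]_d).

(** Restriction to the set where the almost sure bounds hold, so that they
    hold everywhere; the value 0 elsewhere satisfies them too. *)
Definition truncate G u (x : 'cV[R]_d) : 'cV[R]_d := if x \in G then u x else 0.

Lemma truncateE G u x : G x -> truncate G u x = u x.
Proof. by move=> Gx; rewrite /truncate mem_set. Qed.

Lemma bounded_measurable_truncate G u (c : R) : measurable G -> G `<=` D ->
  (forall i, measurable_fun D (fun x => u x i 0)) -> 0 <= c ->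
  (forall x, G x -> enorm (u x) <= c) ->
  forall i, bounded_measurable (fun x => truncate G u x i 0).
Proof.
move=> mG GD mu c0 uc i; split.
  have /(measurable_restrictT (fun x => u x i 0) mG) := measurable_funS mD GD (mu i).
  congr measurable_fun; apply/funext => x; rewrite patchE /truncate.
  by case: ifP => //; rewrite mxE.
exists c => x; apply: le_trans (entry_enorm _ _) _; rewrite /truncate.
by case: (boolP (x \in G)); rewrite ?enorm0// inE => /uc.
Qed.

End truncation.

(** * The multifidelity estimator *)

Theorem proposition4p1 (R : realType) (disp : measure_display)
    (Omega : measurableType disp) (P : probability Omega R)
    (d : nat) (d_gt0 : (0 < d)%N)
    (D : set 'cV[R]_d) (mD : measurable D)
    (rho : 'cV[R]_d -> R) (rhoP : density_on D rho)
    (X : {RV P >-> 'cV[R]_d}) (Xrho : has_density D rho X)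
    (f g : 'cV[R]_d -> R) (gradf gradg : 'cV[R]_d -> 'cV[R]_d)
    (fP : gradient_on D f gradf) (gP : gradient_on D g gradg)
    (f2 : forall i, square_integrable_on D rho (fun x => gradf x i 0))
    (g2 : forall i, square_integrable_on D rho (fun x => gradg x i 0))
    (H_neq0 : active_subspace_mx gradf X != 0)
    (beta theta : R) (beta_gt0 : 0 < beta) (theta_gt0 : 0 < theta)
    (beta_bound : {ae P, forall w,
      ((enorm (gradf (X w)) ^+ 2)%:E <=
       (beta ^+ 2)%:E * 'E_P[fun w' => (enorm (gradf (X w')) ^+ 2)%R])%E})
    (theta_bound : {ae P, forall w,
      ((enorm (gradf (X w) - gradg (X w)) ^+ 2)%:E <=
       (theta ^+ 2)%:E * 'E_P[fun w' => (enorm (gradf (X w')) ^+ 2)%R])%E})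
    (m1 m2 : nat) (m1_gt0 : (0 < m1)%N) (m2_gt0 : (0 < m2)%N)
    (Y : 'I_(m1 + m2) -> {RV P >-> 'cV[R]_d})
    (YX : independent_copies D X Y)
    (m2_ge : m1%:R * Num.max
       ((theta + beta) ^+ 2 * (1 + theta) ^+ 2
          / (theta ^+ 2 * (2 + theta) ^+ 2))
       ((theta + beta) ^+ 2 / (theta * (2 * beta + theta))) <= m2%:R) :
  let H := active_subspace_mx gradf X in
  let Hmf := mf_estimator gradf gradg Y in
  let delta := intrinsic_dim H in
  (forall eps : R, 0 < eps ->
     eps ^- 2 * delta * theta * ln (2 * d%:R)
       * Num.max (4 * delta * theta * (2 + theta) ^+ 2)
                 (2 / 3 * (2 * beta + theta)) <= m1%:R ->
     ('E_P[fun w => opnorm (H - Hmf w)%R]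
       <= ((eps + eps ^+ 2) * opnorm H)%:E)%E)
  /\
  (forall eps eta : R, 0 < eps -> eps <= 1 -> 0 < eta -> eta < 1 ->
     eps ^- 2 * delta * theta * ln (2 * d%:R / eta)
       * (4 * delta * theta * (2 + theta) ^+ 2
          + 4 / 3 * eps * (2 * beta + theta)) <= m1%:R ->
     ((1 - eta)%:E <=
       P [set w | (opnorm (H - Hmf w) <= eps * opnorm H)%R])%E).

Proof.
move=> H Hmf delta.
have [YD YlawX indepY] := YX; have [XD _] := Xrho.
have mX : measurable_fun setT X by exact: measurable_funPT.
have mY i : measurable_fun setT (Y i) by exact: measurable_funPT.
have mf i : measurable_fun D (fun x => gradf x i 0) by have [] := f2 i.
have mg i : measurable_fun D (fun x => gradg x i 0) by have [] := g2 i.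
have mdiff i : measurable_fun D (fun x => (gradf x - gradg x) i 0).
  by under eq_fun do rewrite !mxE; exact: (measurable_funB (mf i) (mg i)).
have msq (u : 'cV[R]_d -> 'cV[R]_d) :
    (forall i, measurable_fun D (fun x => u x i 0)) ->
    measurable_fun D (fun x => enorm (u x) ^+ 2).
  move=> mu; under eq_fun do rewrite enorm_sqr.
  by apply: measurable_sum => i; exact: measurable_funM.
have measX (h : 'cV[R]_d -> R) : measurable_fun D h ->
    measurable_fun setT (fun w => h (X w)).
  by move=> mh; exact: measurable_comp_on mX XD.
(* the scale r of the bounds is the square root of the second moment *)
set T2 := ('E_P[fun w' => (enorm (gradf (X w')) ^+ 2)%R])%E in beta_bound theta_bound.
have T2E : T2 = (\int[P]_w (enorm (gradf (X w)) ^+ 2)%:E)%E by rewrite /T2 unlock.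
have T2_fin : (T2 \is a fin_num)%E.
  rewrite ge0_fin_numE ?T2E; last by apply: integral_ge0 => w _; rewrite lee_fin sqr_ge0.
  under eq_integral do rewrite enorm_sqr -sumEFin.
  rewrite ge0_integral_sum//; last 2 first.
  - move=> i; apply/measurable_EFinP; apply: (measX (fun x => gradf x i 0 * gradf x i 0)).
    by apply: measurable_funM; exact: mf.
  - by move=> i w _; rewrite lee_fin -expr2 sqr_ge0.
  apply/lte_sum_pinfty => i _; have [mfi fi2] := f2 i.
  under eq_integral do rewrite -expr2.
  exact: (density_second_moment mD rhoP Xrho mfi fi2).
set T := fine T2; have TE : T2 = T%:E by rewrite fineK.
have T_ge0 : 0 <= T.
  by rewrite fine_ge0// T2E; apply: integral_ge0 => w _; rewrite lee_fin sqr_ge0.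
pose r := Num.sqrt T.
have r2 : r ^+ 2 = T by rewrite sqr_sqrtr.
have r_ge0 : 0 <= r by exact: sqrtr_ge0.
pose G := D `&` ([set x | enorm (gradf x) ^+ 2 <= beta ^+ 2 * T] `&`
  [set x | enorm (gradf x - gradg x) ^+ 2 <= theta ^+ 2 * T]).
have mG : measurable G.
  have m1' := measurable_fun_ler (msq _ mf) (measurable_cst (beta ^+ 2 * T)).
  have m2' := measurable_fun_ler (msq _ mdiff) (measurable_cst (theta ^+ 2 * T)).
  rewrite /G setIIr; apply: measurableI.
  - exact: (m1' mD [set true] I).
  - exact: (m2' mD [set true] I).
have GD : G `<=` D by move=> x [].
have XG0 : P (X @^-1` (~` G)) = 0%E.
  apply: measure_negligible.
    by rewrite -[_ @^-1` _]setTI; apply: mX => //; exact: measurableC.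
  have /= : {ae P, forall w, G (X w)}.
    apply: filterS2 beta_bound theta_bound => w; rewrite TE -!EFinM !lee_fin => hb ht.
    by split => //; exact: XD.
  by [].
have YG : {ae P, forall w, forall i, G (Y i w)}.
  apply: filter_forall => i.
  have YG0 : P (Y i @^-1` (~` G)) = 0%E.
    by rewrite YlawX//; exact: measurableC.
  exists (Y i @^-1` (~` G)); split => //.
  by rewrite -[_ @^-1` _]setTI; apply: mY => //; exact: measurableC.
have XG : {ae P, forall w, G (X w)}.
  exists (X @^-1` (~` G)); split => //.
  by rewrite -[_ @^-1` _]setTI; apply: mX => //; exact: measurableC.
pose a := truncate G gradf; pose b := truncate G gradg.
have enorm_le (u : 'cV[R]_d) (c : R) : 0 <= c ->
    enorm u ^+ 2 <= c ^+ 2 * T -> enorm u <= c * r.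
  move=> c0; rewrite -r2 -exprMn => h.
  by rewrite -(@ler_pXn2r _ 2)// ?nnegrE ?mulr_ge0 ?enorm_ge0.
have Ga x : G x -> enorm (gradf x) <= beta * r.
  by move=> [_ [h _]]; apply: enorm_le => //; exact: ltW.
have Gab x : G x -> enorm (gradf x - gradg x) <= theta * r.
  by move=> [_ [_ h]]; apply: enorm_le => //; exact: ltW.
have a_le x : enorm (a x) <= beta * r.
  rewrite /a /truncate; case: (boolP (x \in G)); first by rewrite inE => /Ga.
  by rewrite enorm0 mulr_ge0// ltW.
have ab_le x : enorm (a x - b x) <= theta * r.
  rewrite /a /b /truncate; case: (boolP (x \in G)); first by rewrite inE => /Gab.
  by rewrite subrr enorm0 mulr_ge0// ltW.
have bma i : bounded_measurable (fun x => a x i 0).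
  apply: (bounded_measurable_truncate mD mG GD mf _ Ga).
  by rewrite mulr_ge0// ltW.
have bmb i : bounded_measurable (fun x => b x i 0).
  apply: (bounded_measurable_truncate (c := beta * r + theta * r) mD mG GD mg).
    by rewrite addr_ge0// mulr_ge0// ltW.
  move=> x Gx; have -> : gradg x = gradf x - (gradf x - gradg x).
    by apply/colP => j; rewrite !mxE; ring.
  by apply: le_trans (enormD _ _) _; rewrite enormN lerD// ?Ga ?Gab.
have X_moment : Ex P (fun w => dotv (a (X w)) (a (X w))) = r ^+ 2.
  rewrite r2 /T T2E /Ex /Rintegral; congr fine; apply: ae_eq_integral => //.
  - apply/measurable_EFinP; apply: (measurableT_comp (f := fun x => dotv (a x) (a x)) _ mX).
    by have [] := bounded_sqnorm bma.
  - apply/measurable_EFinP; apply: (measX (fun x => enorm (gradf x) ^+ 2)).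
    exact: msq.
  - by apply: filterS XG => w Gw _; rewrite /a truncateE// enorm_sqr.
have HE : H = Ex_mx P (fun w => a (X w) *m (a (X w))^T).
  apply/matrixP => i j; rewrite !mxE /Ex /Rintegral unlock; congr fine.
  apply: ae_eq_integral => //.
  - apply/measurable_EFinP; under eq_fun do rewrite !mxE big_ord1 [_^T _ _]mxE.
    apply: (measX (fun x => gradf x i 0 * gradf x j 0)).
    exact: measurable_funM.
  - apply/measurable_EFinP.
    apply: (measurableT_comp (f := fun x => (a x *m (a x)^T) i j) _ mX).
    by have [] := entries_in_outer bma i j.
  - by apply: filterS XG => w Gw _; rewrite /a truncateE.
have r_gt0 : 0 < r.
  rewrite lt_def r_ge0 andbT; apply: contra H_neq0 => /eqP r0.
  rewrite -/H HE; apply/eqP/matrixP => i j; rewrite !mxE -[RHS](Ex_cst P).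
  congr Ex; apply/funext => w; rewrite !mxE big_ord1 mxE.
  have : enorm (a (X w)) == 0 by rewrite eq_le enorm_ge0 andbT -(mulr0 beta) -r0.
  by rewrite enorm_eq0 => /eqP ->; rewrite mxE mul0r.
have h_gt0 : 0 < opnorm H by exact: opnorm_gt0.
have r2E : r ^+ 2 = delta * opnorm H.
  rewrite /delta /intrinsic_dim divfK ?gt_eqF// HE -X_moment.
  rewrite /dotv Ex_sum; last first.
    move=> i; apply: (bounded_measurable_comp (phi := fun x => a x i 0 * a x i 0)) => //.
    exact: bounded_measurableM.
  apply: eq_bigr => i _; rewrite !mxE; congr Ex; apply/funext => w.
  by rewrite !mxE big_ord1 mxE.
have delta_ge0 : 0 <= delta.
  by rewrite -(pmulr_lge0 _ h_gt0) -r2E sqr_ge0.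
have mHmf : measurable_fun setT (fun w => opnorm (H - Hmf w)).
  apply: measurable_opnorm_sym => [w|].
    rewrite linearB /= HE trmx_Ex_mx; last by move=> w'; exact: trmx_outer.
    congr (_ - _); rewrite /Hmf /mf_estimator linearD !linearZ /=.
    congr (_ + _); congr (_ *: _); rewrite raddf_sum /=; apply: eq_bigr => i _.
      by rewrite linearB /= !trmx_outer.
    by rewrite trmx_outer.
  have algM := @function_algebra_measurable R _ Omega.
  have mouter (u : 'cV[R]_d -> 'cV[R]_d) i :
      (forall j, measurable_fun D (fun x => u x j 0)) ->
      entries_in (fun f : Omega -> R => measurable_fun setT f)
        (fun w => u (Y i w) *m (u (Y i w))^T).
    move=> mu k l; under eq_fun do rewrite !mxE big_ord1 [_^T _ _]mxE.
    by apply: measurable_funM; [apply: (measurable_comp_on mD (mu k))|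
      apply: (measurable_comp_on mD (mu l))].
  apply: (entries_inB algM); first exact: (entries_in_cst algM).
  apply: (entries_inD algM); apply: (entries_inZ algM); apply: (entries_in_sum algM) => i _.
    by apply: (entries_inB algM); exact: mouter.
  exact: mouter.
pose err w := opnorm (Ex_mx P (fun w => a (X w) *m (a (X w))^T)
  - mf_estimator a b Y w).
have errE : {ae P, forall w, opnorm (H - Hmf w) = err w}.
  apply: filterS YG => w Gw; rewrite /err -HE; congr (opnorm (_ - _)).
  rewrite /Hmf /mf_estimator; congr (_ + _); congr (_ *: _); apply: eq_bigr => i _ /=.
    by rewrite /a /b !truncateE.
  by rewrite /b !truncateE.
have berr : bounded_measurable err := bounded_measurable_error beta_gt0 theta_gt0
  r_gt0 bma bmb a_le ab_le m1_gt0 m2_gt0 YlawX X_moment m2_ge.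
have d1 : 1 <= d%:R :> R by rewrite ler1n.
have m1R_gt0 : 0 < m1%:R :> R by rewrite ltr0n.
split=> [eps eps_gt0 m1_ge|eps eta eps_gt0 _ eta_gt0 _ m1_ge].
- have lvl := expectation_sample_size h_gt0 delta_ge0 theta_gt0 eps_gt0 m1R_gt0
    (ln_ge0 (ltac:(lra) : 1 <= 2 * d%:R)) m1_ge.
  have -> : ('E_P[fun w => opnorm (H - Hmf w)] = (Ex P err)%:E)%E.
    rewrite unlock; apply: etrans (Ex_EFin P berr); apply: ae_eq_integral => //.
    - by apply/measurable_EFinP; exact: mHmf.
    - by apply/measurable_EFinP; exact: berr.1.
    - by apply: filterS errE => w /= -> _.
  rewrite lee_fin; apply: le_trans lvl; rewrite -r2E -exprM.
  exact: (Ex_error_le d_gt0 beta_gt0 theta_gt0 r_gt0 bma bmb a_le ab_le m1_gt0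
    m2_gt0 YlawX indepY X_moment m2_ge (mulr_gt0 eps_gt0 h_gt0)).
- have lvl := tail_sample_size h_gt0 eps_gt0 m1R_gt0 m1_ge.
  rewrite -r2E -exprM in lvl.
  have meas_le (W : Omega -> R) (c : R) : measurable_fun setT W ->
      measurable [set w | W w <= c].
    move=> mW; have := measurable_fun_ler mW (measurable_cst c).
    by move=> /(_ measurableT [set true] I); rewrite setTI.
  have -> : P [set w | opnorm (H - Hmf w) <= eps * opnorm H] =
      P [set w | err w <= eps * opnorm H].
    apply: ae_eq_prob; [exact: meas_le mHmf|exact: meas_le berr.1|].
    by apply: filterS errE => w /= ->.
  exact: (error_tail_le d_gt0 beta_gt0 theta_gt0 r_gt0 bma bmb a_le ab_le m1_gt0
    m2_gt0 YlawX indepY X_moment m2_ge (mulr_gt0 eps_gt0 h_gt0) eta_gt0 lvl).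
Qed.
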